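(* Let $0<\xi<\omega_1$, let $(\alpha_n)_{n=0}^\infty$ be a sequence of ordinals with $\sup_{n\in\mathbb{N}\cup\{0\}}\alpha_n=\omega^{\omega^\xi}$ and $\alpha_n<\omega^{\omega^\xi}$ for all $n$, and let $(\theta_n)_{n=1}^\infty$ be a nonincreasing null sequence in $(0,1)$. Then there exists a sequence $(\mathcal{F}_n)_{n=0}^\infty$ of regular families of finite subsets of $\mathbb{N}$ such that $\iota(\mathcal{F}_n)=\alpha_n$ for all $n\in\mathbb{N}\cup\{0\}$ and $I_b(T(\mathcal{F}_0,(\theta_n,\mathcal{F}_n)_{n=1}^\infty))=\omega^{\omega^\xi\cdot2}$.
   Context: Regular family: hereditary, spreading, compact subset of $[\mathbb{N}]^{<\infty}\subseteq2^{\mathbb{N}}$. $\iota(\mathcal{F})$: ordinal $\beta$ with $\mathcal{F}^{(\beta)}=\{\emptyset\}$ (iterated Cantor–Bendixson derived sets). $T(\mathcal{F}_0,(\theta_n,\mathcal{F}_n))$: completion of $c_{00}$ under the norm implicitly defined by $\|x\|=\max\{\|x\|_{\mathcal{F}_0},\sup_n\sup\theta_n\sum_i\|E_ix\|\}$ with $\|\sum a_ke_k\|_{\mathcal{F}}=\sup_{F\in\mathcal{F}}\sum_{k\in F}|a_k|$, $Ex$ the restriction of $x$ to $E$, inner sup over $E_1<\dots<E_k$ ($\max E_i<\min E_{i+1}$) with $\{\min E_i\}\in\mathcal{F}_n$. $I_b(E)=\sup_KI_b(E,K)$, $I_b(E,K)$ the supremum of the orders of $\ell^1$-$K$ block trees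 (trees on the unit sphere, closed under initial segments, whose nodes are finite block bases of the unit vector basis with $\|\sum a_ix_i\|\ge K^{-1}\sum|a_i|$); order $o(T)$ = least $\beta$ with $D^\beta(T)=\emptyset$, $D$ removing nodes without proper extensions, iterated transfinitely.
   Formalization: The norm of T is taken with the sup norm added to the maximum in its defining equation, since for α_0=0 (F_0={∅}) the literal equation has only the zero solution and the claim fails; if F_0 contains all singletons the norm is unchanged. *)

(* Defs.v *)
From HB Require Import structures.
From mathcomp Require Import all_boot all_order all_algebra.
From mathcomp Require Import boolp classical_sets functions cardinality fsbigop reals.
Set Implicit Arguments. Unset Strict Implicit. Unset Printing Implicit Defensive.
Import Order.TTheory GRing.Theory Num.Theory.
Local Open Scope classical_set_scope.
Local Open Scope ring_scope.

(* Countable ordinals (< omega_1) as Brouwer trees.                    *)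
Inductive ord : Type :=
| OZ : ord
| OS : ord -> ord
| OL : (nat -> ord) -> ord.   (* OL f = sup_n f n *)

Inductive ole : ord -> ord -> Prop :=
| ole_Z b : ole OZ b
| ole_S a b : olt a b -> ole (OS a) b
| ole_L f b : (forall n, ole (f n) b) -> ole (OL f) b
with olt : ord -> ord -> Prop :=
| olt_S a b : ole a b -> olt a (OS b)
| olt_L a g n : olt a (g n) -> olt a (OL g).

Definition oeq (a b : ord) : Prop := ole a b /\ ole b a.

Fixpoint oadd (a b : ord) : ord :=
  match b with OZ => a | OS b' => OS (oadd a b') | OL f => OL (fun n => oadd a (f n)) end.
Fixpoint omul (a b : ord) : ord :=
  match b with OZ => OZ | OS b' => oadd (omul a b') a | OL f => OL (fun n => omul a (f n)) end.
Fixpoint oexp (a b : ord) : ord :=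
  match b with OZ => OS OZ | OS b' => omul (oexp a b') a | OL f => OL (fun n => oexp a (f n)) end.
Definition ofin (n : nat) : ord := iter n OS OZ.
Definition omega : ord := OL ofin.

Definition fam := set (set nat).

(* agree on the initial segment [0,n) : basic neighbourhoods of 2^N *)
Definition agree (n : nat) (A B : set nat) : Prop :=
  forall k, (k < n)%N -> (A k <-> B k).

(* Cantor-Bendixson derived set: limit points of F in 2^N *)
Definition derived (F : fam) : fam :=
  [set A | forall n, exists B, F B /\ B <> A /\ agree n A B].

Fixpoint oderiv (F : fam) (b : ord) : fam :=
  match b with
  | OZ => F
  | OS b' => derived (oderiv F b')
  | OL f => [set A | forall n, oderiv F (f n) A]
  end.

Definition CB_index (F : fam) (a : ord) : Prop := oderiv F a = [set set0].

Definition hereditary (F : fam) : Prop :=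
  forall A B, F A -> B `<=` A -> F B.

Definition spreading (F : fam) : Prop :=
  forall s t : seq nat, sorted ltn s -> sorted ltn t -> size s = size t ->
    (forall i, (i < size s)%N -> (nth 0%N s i <= nth 0%N t i)%N) ->
    F [set k | k \in s] -> F [set k | k \in t].

(* compact subset of 2^N contained in [N]^{<oo} *)
Definition compact_fam (F : fam) : Prop :=
  (forall A, F A -> finite_set A) /\
  (forall A : set nat, (forall n, exists B, F B /\ agree n A B) -> F A).

Definition regular (F : fam) : Prop :=
  hereditary F /\ spreading F /\ compact_fam F.

Section Tsirelson.
Variable R : realType.
Implicit Types (x : nat -> R).

Definition c00 x : Prop := finite_set [set k | x k != 0].

Definition restr (E : set nat) x : nat -> R := fun k => if k \in E then x k else 0.

Definition supnorm x : R := sup (range (fun k => `|x k|)).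

Definition normF (F : fam) x : R :=
  sup [set t | exists A, F A /\ t = \sum_(k \in A) `|x k|].

Definition is_min (m : nat) (E : set nat) : Prop := E m /\ forall k, E k -> (m <= k)%N.

Definition admissible (G : fam) (Es : seq (set nat)) : Prop :=
  (forall i, (i < size Es)%N -> finite_set (nth set0 Es i) /\ nth set0 Es i !=set0) /\
  (forall i j, (i < j < size Es)%N -> forall a b,
      nth set0 Es i a -> nth set0 Es j b -> (a < b)%N) /\
  G [set m | exists i, (i < size Es)%N /\ is_min m (nth set0 Es i)].

Variables (F0 : fam) (Fs : nat -> fam) (theta : nat -> R).

Definition Tstep (N : (nat -> R) -> R) x : R :=
  sup [set t | exists n Es, (0 < n)%N /\ admissible (Fs n) Es /\
                  t = theta n * \sum_(E <- Es) N (restr E x)].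

(* increasing iteration; its limit is the implicitly defined norm *)
Fixpoint Tnorm_it (m : nat) x : R :=
  match m with
  | 0%N => Num.max (supnorm x) (normF F0 x)
  | m'.+1 => Num.max (Tnorm_it m' x) (Num.max (normF F0 x) (Tstep (Tnorm_it m') x))
  end.

Definition Tnorm x : R := sup (range (fun m => Tnorm_it m x)).
End Tsirelson.

Section Bourgain.
Variable R : realType.
Variable N : (nat -> R) -> R.  (* norm on c00 *)

Definition vzero : nat -> R := fun _ => 0.

Definition l1K_node (K : R) (s : seq (nat -> R)) : Prop :=
  (forall i, (i < size s)%N -> c00 (nth vzero s i) /\ N (nth vzero s i) = 1) /\
  (forall i j, (i < j < size s)%N -> forall a b,
      nth vzero s i a != 0 -> nth vzero s j b != 0 -> (a < b)%N) /\
  (forall c : nat -> R,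
      K^-1 * \sum_(i < size s) `|c i| <=
      N (fun k => \sum_(i < size s) c i * nth vzero s i k)).

Definition l1K_tree (K : R) (T : set (seq (nat -> R))) : Prop :=
  (forall s, T s -> s <> [::]) /\
  (forall s n, T s -> (0 < n)%N -> T (take n s)) /\
  (forall s, T s -> l1K_node K s).

Definition tD (T : set (seq (nat -> R))) : set (seq (nat -> R)) :=
  [set s | T s /\ exists t, T t /\ (size s < size t)%N /\ take (size s) t = s].

Fixpoint tderiv (T : set (seq (nat -> R))) (b : ord) : set (seq (nat -> R)) :=
  match b with
  | OZ => T
  | OS b' => tD (tderiv T b')
  | OL f => [set s | forall n, tderiv T (f n) s]
  end.

(* I_b(E) = g, i.e. sup_{K>=1} sup_T o(T) = g, where o(T) <= b iff D^b(T) = empty *)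
Definition Ib_eq (g : ord) : Prop :=
  (forall K T, 1 <= K -> l1K_tree K T -> tderiv T g = set0) /\
  (forall b, olt b g -> exists K T, 1 <= K /\ l1K_tree K T /\ tderiv T b !=set0).
End Bourgain.

(* Main.v *)
(* Write [Om] for omega^(omega^xi), so that the claimed index is [Om * Om].

   Upper bound, valid for all families of the kind used here. In an l1-block tree of order
   [Om * Om], first replace the vectors by convex combinations taken over pieces of order
   [Om * N]; these are so spread out that theta_m with m >= n0 no longer contributes to their
   norm. The families with m < n0 have order below [Om], and averaging over pieces of order
   below [Om] multiplies norms by theta_1 up to a small error. As [Om] is multiplicatively
   indecomposable, finitely many repetitions stay below [Om * Om] and bring the norm of a
   convex combination of a node below 1/K.

   Lower bound. The families are chosen on rapidly growing scales: F_n contains unions of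
   blocks A whose lengths dwarf the traces of F_0, ..., F_(n-1), so the average over A has norm
   at most 2 theta_n while theta_n F_n norms it by theta_n. The normalized blocks thus form
   2-l1-trees of every order below [Om], and grouping them along F_k gives trees of order
   [Om * alpha_k] with constant 2 / theta_k. *)
Require Import Defs.
From Stdlib Require List.
From HB Require Import structures.
From mathcomp Require Import all_boot all_order all_algebra.
From mathcomp Require Import boolp classical_sets functions cardinality fsbigop reals.
From mathcomp Require Import lra.
Import Order.TTheory GRing.Theory Num.Theory.
Local Open Scope classical_set_scope.
Local Open Scope ring_scope.
Set Implicit Arguments. Unset Strict Implicit. Unset Printing Implicit Defensive.

(** * Brouwer ordinals *)

(* Countable ordinals are Brouwer trees, and the given [alpha n] come with arbitrary fundamental
   sequences. An inequality between orders is therefore too weak to compare sets or branches. The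
   proof compares the lists of budgets along which one can count down. Passing to another tree costs
   one function applied to all budgets, and this price can always be paid: the Cantor-Bendixson
   index of a family does not depend on its scale, and the budgets put on a tree of vectors may be
   raised at will. The same lists describe membership in a family and the positions on which an
   average must have small mass, which is how families are matched against block trees.

   No order below [Om] bounds all [alpha n], so the tail of the families is met by covers of
   [OL alpha]. This spends [Om] itself, but only once, since the resulting smallness is preserved by
   further averaging.

   In the lower bound, a union of blocks indexed by an [alpha i]-cover has order [omega * alpha i]
   and must still fit into one family. Since [Om] is closed under multiplication and not attained,
   some later [alpha n] has this size. *)
Scheme ole_mind := Minimality for ole Sort Prop
  with olt_mind := Minimality for olt Sort Prop.
Combined Scheme ole_olt_ind from ole_mind, olt_mind.

Lemma ole_SE a b : ole (OS a) b <-> olt a b.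
Proof. by split=> [h|]; [inversion h | exact: ole_S]. Qed.

Lemma ole_LE f b : ole (OL f) b <-> forall n, ole (f n) b.
Proof. by split=> [h|]; [inversion h | exact: ole_L]. Qed.

Lemma olt_SE a b : olt a (OS b) <-> ole a b.
Proof. by split=> [h|]; [inversion h | exact: olt_S]. Qed.

Lemma olt_LE a g : olt a (OL g) <-> exists n, olt a (g n).
Proof.
by split=> [h|[n]]; [inversion h as [|? ? n hn]; exists n | exact: olt_L].
Qed.

Lemma olt_ZE a : ~ olt a OZ.
Proof. by move=> h; inversion h. Qed.

Lemma ole_limr a g n : ole a (g n) -> ole a (OL g).
Proof.
elim: a => [_|a _ /ole_SE h|f IH /ole_LE h]; first exact: ole_Z.
  by apply/ole_SE; apply: olt_L h.
by apply/ole_LE => m; apply: IH.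
Qed.

Lemma ole_refl a : ole a a.
Proof.
elim: a => [|a IH|f IH]; first exact: ole_Z.
- by apply/ole_SE/olt_SE.
- by apply/ole_LE => n; apply: ole_limr (IH n).
Qed.
#[local] Hint Resolve ole_refl : core.

Lemma ole_ltW a b : olt a b -> ole a b.
Proof.
have sub : forall c, (forall d, ole c d -> ole c (OS d)).
  elim=> [|c IH|f IH] d h; first exact: ole_Z.
  - apply/ole_SE/olt_SE; move/ole_SE: h.
    case: d => [|d|g] h; first by case: (olt_ZE h).
    + by apply: IH; apply/olt_SE.
    + move: h => /olt_LE[n h]; apply: (@ole_limr _ _ n).
      elim: (g n) h => [/olt_ZE//|d _ /olt_SE /IH//|k IHk /olt_LE[m /IHk]].
      exact: ole_limr.
  - by apply/ole_LE => n; apply: IH; move/ole_LE: h.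
elim: b => [/olt_ZE//|b _ /olt_SE/sub//|g IH /olt_LE[n /IH]].
exact: ole_limr.
Qed.

(** The two halves feed each other: [OS a] is below [b] exactly if [a] is strictly below [b], and
    the alternative to that is the other half for [a]. *)
Lemma ole_olt_total a b : (ole a b \/ olt b a) /\ (ole b a \/ olt a b).
Proof.
elim: a b => [|a IH|f IH] b.
- split; first by left; exact: ole_Z.
  elim: b => [|b IHb|g IHb]; first by left.
  + by right; apply/olt_SE; exact: ole_Z.
  + have [h|/existsNP[n hn]] := pselect (forall n, ole (g n) OZ).
      by left; apply/ole_LE.
    by right; apply/olt_LE; exists n; case: (IHb n).
- split.
    by rewrite ole_SE olt_SE; case: (IH b) => _ []; [right|left].
  elim: b => [|b IHb|g IHb]; first by left; exact: ole_Z.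
  + by rewrite ole_SE !olt_SE ole_SE; case: (IH b).2; [left|right].
  + have [h|/existsNP[n hn]] := pselect (forall n, ole (g n) (OS a)).
      by left; apply/ole_LE.
    by right; apply/olt_LE; exists n; case: (IHb n).
- split.
    have [h|/existsNP[n hn]] := pselect (forall n, ole (f n) b).
      by left; apply/ole_LE.
    by right; apply/olt_LE; exists n; case: (IH n b) => [][].
  elim: b => [|b IHb|g IHb]; first by left; exact: ole_Z.
  + have [[n h]|h] := pselect (exists n, olt b (f n)).
      by left; apply/ole_SE/olt_LE; exists n.
    right; apply/olt_SE/ole_LE => n.
    by case: (IH n b) => [][]// h'; case: h; exists n.
  + have [h|/existsNP[n hn]] := pselect (forall n, ole (g n) (OL f)).
      by left; apply/ole_LE.
    by right; apply/olt_LE; exists n; case: (IHb n).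
Qed.

Lemma ole_trans b a c : ole a b -> ole b c -> ole a c.
Proof.
suff H : forall b, (forall a c, ole a b -> ole b c -> ole a c) /\
                   (forall a c, olt a b -> ole b c -> olt a c).
  exact: (H b).1.
move=> {a b c}; elim=> [|b [IH1 IH2]|g IH].
- split=> [a c h _|a c /olt_ZE//].
  by elim: a h => [_|a _ /ole_SE/olt_ZE//|f IHf /ole_LE h];
    [exact: ole_Z|apply/ole_LE => n; apply: IHf].
- have lt : forall a c, olt a (OS b) -> ole (OS b) c -> olt a c.
    move=> a c /olt_SE ab /ole_SE; elim: c => [/olt_ZE//|c _ /olt_SE bc|k IHk].
      by apply/olt_SE; apply: IH1 bc.
    by move=> /olt_LE[n /IHk h]; apply/olt_LE; exists n.
  split=> // a c; elim: a => [_ _|a _|f IHf]; first exact: ole_Z.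
    by move=> /ole_SE h1 h2; apply/ole_SE; apply: lt h2.
  by move=> /ole_LE h1 h2; apply/ole_LE => n; apply: IHf.
- have lt : forall a c, olt a (OL g) -> ole (OL g) c -> olt a c.
    by move=> a c /olt_LE[n h] /ole_LE h'; apply: (IH n).2 (h' n).
  split=> // a c; elim: a => [_ _|a _|f IHf]; first exact: ole_Z.
    by move=> /ole_SE h1 h2; apply/ole_SE; apply: lt h2.
  by move=> /ole_LE h1 h2; apply/ole_LE => n; apply: IHf.
Qed.

Lemma olt_le_trans b a c : olt a b -> ole b c -> olt a c.
Proof. by move=> /ole_SE h1 h2; apply/ole_SE; apply: ole_trans h2. Qed.

Lemma ole_lt_trans b a c : ole a b -> olt b c -> olt a c.
Proof.
move=> ab /ole_SE h2; apply: olt_le_trans h2.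
by apply/olt_SE.
Qed.

Lemma olt_irr a : ~ olt a a.
Proof.
elim: a => [/olt_ZE//|a IH|f IH].
- by move=> /olt_SE /ole_SE.
- move=> /olt_LE[n h]; apply: (IH n); apply: ole_lt_trans h.
  exact: ole_limr.
Qed.

Lemma ole_total a b : ole a b \/ ole b a.
Proof. by case: (ole_olt_total a b).1 => [|/ole_ltW]; [left|right]. Qed.

Lemma oleNgt a b : ~ ole a b -> olt b a.
Proof. by case: (ole_olt_total a b).1. Qed.

(** A budget [v] admits only the branches of index at most [v]; the largest of them serves for
    all. *)
Lemma ole_max_below (f : nat -> ord) v :
  exists2 n, (n <= v)%N & forall k, (k <= v)%N -> ole (f k) (f n).
Proof.
elim: v => [|v [n nv IH]]; first by exists 0%N => // k; rewrite leqn0 => /eqP->.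
have [h|h] := ole_total (f n) (f v.+1).
  exists v.+1 => // k; rewrite leq_eqVlt => /orP[/eqP->//|].
  by rewrite ltnS => /IH h'; apply: ole_trans h.
exists n; first by rewrite leqW.
by move=> k; rewrite leq_eqVlt => /orP[/eqP->//|]; rewrite ltnS => /IH.
Qed.

(** * Ordinal arithmetic on trees *)

Lemma oadd0o a : oadd OZ a = a.
Proof. by elim: a => [|a /= ->|f IH]//=; congr OL; apply/funext. Qed.

(** Recursion on the right argument commutes with limits, so this law and the next ones are
    equalities of trees and not only of ordinals. They can thus be used inside covers and tree
    derivatives, which see the tree. *)
Lemma oaddA a b c : oadd a (oadd b c) = oadd (oadd a b) c.
Proof. by elim: c => [|c /= ->|f IH]//=; congr OL; apply/funext. Qed.

Lemma omulDr a b c : omul a (oadd b c) = oadd (omul a b) (omul a c).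
Proof.
elim: c => [|c /= ->|f IH]//=; first by rewrite oaddA.
by congr OL; apply/funext.
Qed.

Lemma omulA a b c : omul a (omul b c) = omul (omul a b) c.
Proof.
elim: c => [|c IH|f IH]//=; first by rewrite omulDr IH.
by congr OL; apply/funext.
Qed.

Lemma oexpD a b c : oexp a (oadd b c) = omul (oexp a b) (oexp a c).
Proof.
elim: c => [|c IH|f IH]//=; first by rewrite oadd0o.
  by rewrite IH omulA.
by congr OL; apply/funext.
Qed.

Lemma ofinD m n : ofin (m + n) = oadd (ofin m) (ofin n).
Proof. by elim: n => [|n IH]; rewrite ?addn0 ?addnS //= -IH. Qed.

Lemma oadd_le2l a b c : ole b c -> ole (oadd a b) (oadd a c).
Proof.
suff H : (forall b c, ole b c -> ole (oadd a b) (oadd a c)) /\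
         (forall b c, olt b c -> olt (oadd a b) (oadd a c)) by exact: H.1.
apply: ole_olt_ind => [{}c|{}b {}c _|f {}c _ IH|{}b {}c _|{}b g n _] /=.
- by elim: c => [//|c IH|g IH] /=; [apply: ole_trans IH (ole_ltW _); apply/olt_SE|
    apply: (@ole_limr _ _ 0%N)].
- by move/ole_SE.
- by apply/ole_LE.
- by move/olt_SE.
- by move=> h; apply/olt_LE; exists n.
Qed.

Lemma oadd_lt2l a b c : olt b c -> olt (oadd a b) (oadd a c).
Proof. by move=> /ole_SE/(oadd_le2l a)/ole_SE. Qed.

Lemma oadd_le2r c a b : ole a b -> ole (oadd a c) (oadd b c).
Proof.
move=> ab; elim: c => [//|c IH|f IH] /=.
  by apply/ole_SE/olt_SE.
by apply/ole_LE => n; apply: (@ole_limr _ _ n).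
Qed.

Lemma oadd_ler a b : ole a (oadd a b).
Proof. by have := oadd_le2l a (ole_Z b). Qed.

Lemma omul_le2l a b c : ole b c -> ole (omul a b) (omul a c).
Proof.
suff H : (forall b c, ole b c -> ole (omul a b) (omul a c)) /\
         (forall b c, olt b c -> ole (oadd (omul a b) a) (omul a c)) by exact: H.1.
apply: ole_olt_ind => [{}c|{}b {}c _|f {}c _ IH|{}b {}c _|{}b g n _] //=.
- exact: ole_Z.
- by apply/ole_LE.
- by move=> h; apply: oadd_le2r.
- by move=> h; apply: (@ole_limr _ _ n).
Qed.

Lemma omul_le2r c a b : ole a b -> ole (omul a c) (omul b c).
Proof.
move=> ab; elim: c => [//|c IH|f IH] /=.
  by apply: ole_trans (oadd_le2l _ ab); apply: oadd_le2r.
by apply/ole_LE => n; apply: (@ole_limr _ _ n).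
Qed.

Lemma oexp_gt0 b : ole (OS OZ) (oexp omega b).
Proof.
elim: b => [//|b IH|f IH] /=; last exact: (@ole_limr _ _ 0%N).
by apply: (@ole_limr _ _ 1%N) => /=; rewrite oadd0o.
Qed.

Lemma oexp_le b c : ole b c -> ole (oexp omega b) (oexp omega c).
Proof.
suff H : (forall b c, ole b c -> ole (oexp omega b) (oexp omega c)) /\
  (forall b c, olt b c -> ole (oexp omega (OS b)) (oexp omega c)) by exact: H.1.
apply: ole_olt_ind => [{}c|{}b {}c _|f {}c _ IH|{}b {}c _|{}b g n _] //=.
- exact: oexp_gt0.
- by apply/ole_LE.
- move=> h; apply/ole_LE => n; apply: (@ole_limr _ _ n).
  exact: omul_le2r.
- by move=> h; apply: (@ole_limr _ _ n).
Qed.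

Lemma oexp_mulfin_lt b n : olt (omul (oexp omega b) (ofin n)) (oexp omega (OS b)).
Proof.
apply/olt_LE; exists n.+1 => /=.
have := @oadd_lt2l (omul (oexp omega b) (ofin n)) OZ (oexp omega b).
by apply; apply/ole_SE; exact: oexp_gt0.
Qed.

Lemma oexp_lt b c : olt b c -> olt (oexp omega b) (oexp omega c).
Proof.
move=> /ole_SE /oexp_le h; apply: olt_le_trans h.
by have := oexp_mulfin_lt b 1; rewrite /= oadd0o.
Qed.

Lemma olt_oexpP a b : olt a (oexp omega b) ->
  ole a OZ \/ exists2 c, olt c b & exists n, olt a (omul (oexp omega c) (ofin n)).
Proof.
elim: b => [/olt_SE|b _ /olt_LE[n h]|f IH /olt_LE[n /IH[|[c h1 h2]]]]; [by left| |by left|].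
  by right; exists b; [exact/olt_SE|exists n].
by right; exists c => //; apply/olt_LE; exists n.
Qed.

Lemma oexp_addclosed x a b : olt a (oexp omega x) -> olt b (oexp omega x) ->
  olt (oadd a b) (oexp omega x).
Proof.
elim: x a b => [|x _|f IH] a b.
- move=> /olt_SE h1 /olt_SE h2; apply/olt_SE.
  by apply: ole_trans (oadd_le2l _ h2) _.
- move=> /olt_LE[n h1] /olt_LE[m h2]; apply/olt_LE; exists (n + m)%N.
  change (olt (oadd a b) (omul (oexp omega x) (ofin (n + m)))).
  rewrite ofinD omulDr; apply: olt_le_trans (oadd_lt2l _ h2) _.
  by apply: oadd_le2r; exact: ole_ltW.
- move=> /olt_LE[n h1] /olt_LE[m h2].
  have [h|h] := ole_total (oexp omega (f n)) (oexp omega (f m)); apply/olt_LE.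
    by exists m; apply: IH => //; apply: olt_le_trans h.
  by exists n; apply: IH => //; apply: olt_le_trans h.
Qed.

(** * Multiplicative indecomposability of omega^(omega^xi) *)

Section Indecomposable.
Variable xi : ord.
Hypothesis xi_gt0 : olt OZ xi.
Let W := oexp omega xi.

(** Positivity of [xi] enters here: for [xi = 0] one would have [W = 1], and omega^W would be omega
    itself. *)
Lemma one_lt_W : olt (OS OZ) W.
Proof.
apply: olt_le_trans (_ : ole (oexp omega (OS OZ)) W).
  by apply/olt_LE; exists 2%N; apply/olt_SE.
by apply: oexp_le; apply/ole_SE.
Qed.

Lemma olt_oexpW a : olt a (oexp omega W) -> exists2 c, olt c W & ole a (oexp omega c).
Proof.
move=> /olt_oexpP[h|[c cW [n h]]].
  by exists OZ; [apply: ole_lt_trans (ole_Z _) one_lt_W|apply: ole_trans h (ole_Z _)].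
exists (OS c); last by apply: ole_ltW; apply: ole_lt_trans (ole_ltW h) (oexp_mulfin_lt _ _).
exact: oexp_addclosed cW one_lt_W.
Qed.

(** Exponents add under multiplication, and [W], itself a power of omega, is closed under
    addition. *)
Lemma oexpW_mulclosed a b : olt a (oexp omega W) -> olt b (oexp omega W) ->
  olt (omul a b) (oexp omega W).
Proof.
move=> /olt_oexpW[c cW ac] /olt_oexpW[d dW bd].
apply: ole_lt_trans (_ : ole _ (oexp omega (oadd c d))) _.
  by rewrite oexpD; apply: ole_trans (omul_le2l _ bd); exact: omul_le2r.
by apply: oexp_lt; exact: oexp_addclosed.
Qed.

Lemma omega_lt_oexpW : olt omega (oexp omega W).
Proof.
have e : omega = oexp omega (OS OZ).
  rewrite /=; congr OL; apply/funext => n; elim: n => [|n IH]//=.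
  by rewrite -IH.
by rewrite [X in olt X _]e; apply: oexp_lt; exact: one_lt_W.
Qed.

End Indecomposable.

(** * Covers and regular families *)

(* A list of budgets [vs] is an [a]-cover if one can count down from [a] along it: at an
   entry [v], limits are resolved by choosing a branch of index at most [v], and then one
   successor is stripped. *)
Fixpoint down (a : ord) (v : nat) (c : ord) : Prop :=
  match a with
  | OZ => False
  | OS a' => c = a'
  | OL f => exists2 n, (n <= v)%N & down (f n) v c
  end.

Fixpoint cov (a : ord) (vs : seq nat) : Prop :=
  match vs with
  | [::] => True
  | v :: vs' => exists2 c, down a v c & cov c vs'
  end.

Lemma down_le a v w c : (v <= w)%N -> down a v c -> down a w c.
Proof.
move=> vw; elim: a => [//|//|f IH] /= [n nv /IH h].
by exists n => //; apply: leq_trans vw.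
Qed.

Lemma down_lt a v c : down a v c -> olt c a.
Proof.
elim: a => [//|a _ /= ->|f IH /= [n _ /IH h]]; first exact/olt_SE.
by apply/olt_LE; exists n.
Qed.

Lemma cov_le a vs ws : all2 leq vs ws -> cov a vs -> cov a ws.
Proof.
elim: vs ws a => [|v vs IH] [|w ws]//= a /andP[vw h] [c dc /(IH _ _ h) h'].
by exists c => //; apply: down_le dc.
Qed.

(** After an entry is dropped, each later entry takes over the choice of its predecessor. It can do
    so because budgets increase; heredity of the families rests on this. *)
Lemma cov_down a v c vs : path leq v vs -> down a v c -> cov c vs -> cov a vs.
Proof.
elim: vs a v c => [//|w ws IH] a v c /= /andP[vw p] dc [d dd h].
by exists c; [exact: down_le dc|exact: IH dd h].
Qed.

Lemma cov_catl a vs ws : cov a (vs ++ ws) -> cov a vs.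
Proof. by elim: vs a => [//|v vs IH] a /= [c h /IH]; exists c. Qed.

Lemma cov_subseq a us vs : sorted leq vs -> subseq us vs -> cov a vs -> cov a us.
Proof.
elim: vs us a => [|v vs IH] us a; first by rewrite subseq0 => _ /eqP->.
move=> /= p; case: us => [//|u us] /=; case: eqP => [->|_] s [c dc h].
  by exists c => //; apply: IH h => //; exact: path_sorted p.
apply: IH s _; first exact: path_sorted p.
exact: cov_down dc h.
Qed.

Lemma cov_OLE f v vs :
  cov (OL f) (v :: vs) <-> exists2 n, (n <= v)%N & cov (f n) (v :: vs).
Proof.
split=> [/= [c [n nv d] h]|[n nv /= [c d h]]]; first by exists n => //; exists c.
by exists c => //; exists n.
Qed.

Lemma cov_OSE a v vs : cov (OS a) (v :: vs) <-> cov a vs.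
Proof. by split=> [/= [c ->]|h] //; exists a. Qed.

Lemma cov_OS a vs : sorted leq vs -> cov a vs -> cov (OS a) vs.
Proof.
case: vs => [//|v vs] s [c d h]; exists a => //.
exact: cov_down d h.
Qed.

(** Replaces comparison of ordinals: two trees for the same ordinal may have different covers, and
    [psi] bridges the difference uniformly in the cover. *)
Definition dominates (psi : nat -> nat) (a b : ord) : Prop :=
  forall vs, sorted leq vs -> cov a vs -> cov b (map psi vs).

Lemma dominates_le (psi psi' : nat -> nat) a b :
  (forall v, psi v <= psi' v)%N -> dominates psi a b -> dominates psi' a b.
Proof.
move=> h d vs s /(d _ s); apply: cov_le.
by elim: vs {s} => [//|v vs IH] /=; rewrite h.
Qed.

Lemma all2_map_leq (T : eqType) (f g : T -> nat) s :
  {in s, forall x, (f x <= g x)%N} -> all2 leq (map f s) (map g s).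
Proof.
elim: s => [//|x s IH] h /=; rewrite h ?mem_head //=; apply: IH => y ys.
by apply: h; rewrite in_cons ys orbT.
Qed.

Lemma mono_max_below (p : nat -> nat -> nat) :
  (forall n, {homo p n : v w / (v <= w)%N}) ->
  {homo (fun v => \max_(n < v.+1) p n v) : v w / (v <= w)%N}.
Proof.
move=> h v w vw; apply/bigmax_leqP => i _.
have iw : (i < w.+1)%N by exact: leq_trans (ltn_ord i) _.
by apply: leq_trans (leq_bigmax (Ordinal iw)) => /=; apply: h.
Qed.

Lemma leq_max_below (p : nat -> nat -> nat) n v : (n <= v)%N ->
  (p n v <= \max_(k < v.+1) p k v)%N.
Proof.
rewrite -ltnS => nv; exact: (leq_bigmax (F := fun k : 'I_v.+1 => p k v) (Ordinal nv)).
Qed.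

(* The comparison is uniform: enlarging every budget by one fixed function turns
   an [a]-cover into a [b]-cover. *)
Lemma ole_dominates a b : ole a b ->
  exists2 psi, {homo psi : v w / (v <= w)%N} & dominates psi a b.
Proof.
pose P a b := exists2 psi, {homo psi : v w / (v <= w)%N} & dominates psi a b.
suff H : (forall a b, ole a b -> P a b) /\ (forall a b, olt a b -> P (OS a) b) by exact: H.1.
apply: ole_olt_ind => [{}b|//|f {}b _ IH|{}a {}b _ [psi m d]|{}a g n _ [psi m d]].
- by exists id => // -[//|v vs] _ [].
- have /choice[p hp] : forall n, exists q,
      {homo q : v w / (v <= w)%N} /\ dominates q (f n) b.
    by move=> n; have [q ? ?] := IH n; exists q.
  (* The branch [n] taken at the first entry is at most that entry, hence at most every later one,
     so [p n] is always among the functions in the maximum. *)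
  exists (fun v => \max_(n < v.+1) p n v).
    by apply: mono_max_below => n; case: (hp n).
  move=> [//|v vs] s /cov_OLE[n nv /((hp n).2 _ s)]; apply: cov_le.
  apply: all2_map_leq => w wv; apply: leq_max_below.
  apply: leq_trans nv _; move: wv; rewrite in_cons => /orP[/eqP->//|].
  by move: s => /= /(order_path_min leq_trans)/allP; apply.
- exists psi => // -[//|v vs] s /cov_OSE h.
  by apply/cov_OSE; apply: d => //; exact: path_sorted s.
- exists (fun v => maxn n (psi v)).
    by move=> v w vw; rewrite geq_max leq_maxl leq_max (m _ _ vw) orbT.
  move=> [//|v vs] s h; apply/cov_OLE; exists n; first exact: leq_maxl.
  apply: (@dominates_le psi _ _ _ _ d (v :: vs)) => // w; exact: leq_maxr.
Qed.

Lemma down_oadd a b v c : down (oadd a b) v c ->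
  (exists2 c', down b v c' & c = oadd a c') \/ down a v c.
Proof.
elim: b => [|b _ /= ->|f IH /= [n nv /IH[[c' d ->]|]]]; [by right| | |by right].
  by left; exists b.
by left; exists c' => //; exists n.
Qed.

(** Counting down from [oadd a b] exhausts [b] before it touches [a], so the initial part of the
    cover belongs to the right summand. *)
Lemma cov_oadd a b vs : cov (oadd a b) vs ->
  exists us ws, [/\ vs = us ++ ws, cov b us & cov a ws].
Proof.
elim: vs b => [|v vs IH] b /=; first by exists [::], [::].
move=> [c /down_oadd[[c' d ->]|d] h].
  have [us [ws [-> h1 h2]]] := IH _ h; exists (v :: us), ws; split=> //.
  by exists c'.
by exists [::], (v :: vs); split=> //; exists c.
Qed.

Lemma cov_oaddfin a n v vs : cov a vs -> cov (oadd a (ofin n)) (nseq n v ++ vs).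
Proof. by move=> h; elim: n => [//|n IH] /=; exists (oadd a (ofin n)). Qed.

Lemma cov_omul_omega_cat b v c n l : (0 < n <= v)%N -> down b v c ->
  cov (omul omega c) l -> cov (omul omega b) (nseq n v ++ l).
Proof.
case: n => [//|n] nv d h; elim: b d => [//|b _ /= e|f IH /= [m mv /IH h']].
  rewrite {}e in h; apply/cov_OLE; exists n.+1 => //.
  exact: (cov_oaddfin n.+1 v h).
by apply/cov_OLE; exists m.
Qed.

(** A successor step of [b] becomes a copy of omega, which a budget [v] resolves to any finite
    ordinal up to [v]. An entry may thus be repeated as often as its own budget allows; this makes
    room for long blocks. *)
Lemma cov_omul_omega b (ps : seq (nat * nat)) :
  all (fun p => 0 < p.1 <= p.2)%N ps -> cov b (map snd ps) ->
  cov (omul omega b) (flatten [seq nseq p.1 p.2 | p <- ps]).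
Proof.
elim: ps b => [//|p ps IH] b /= /andP[hp hps] [c d hc].
exact: cov_omul_omega_cat d (IH _ hps hc).
Qed.

(** The length of a longest cover whose entries are all at most [v]; it will bound the traces of the
    earlier families. *)
Fixpoint len (a : ord) (v : nat) : nat :=
  match a with
  | OZ => 0
  | OS a' => (len a' v).+1
  | OL f => \max_(n < v.+1) len (f n) v
  end.

Lemma len_le a : {homo len a : v w / (v <= w)%N}.
Proof.
elim: a => [//|a IH v w /IH//|f IH].
exact: (@mono_max_below (fun n => len (f n))) IH.
Qed.

Lemma down_len a v c : down a v c -> (len c v < len a v)%N.
Proof.
elim: a => [//|a _ /= ->//|f IH /= [n nv /IH h]].
by apply: leq_trans h _; exact: (@leq_max_below (fun k => len (f k))).
Qed.

Lemma cov_size a v vs : all (fun w => w <= v)%N vs -> cov a vs -> (size vs <= len a v)%N.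
Proof.
elim: vs a => [//|w vs IH] a /= /andP[wv h] [c /(down_le wv)/down_len d /(IH _ h) h'].
exact: leq_ltn_trans h' d.
Qed.

(** The countdown is finitely branching: the entry [v 0] leaves finitely many branches at a limit,
    so the largest of their failure lengths works for all. *)
Lemma cov_infinite a (v : nat -> nat) : exists k, ~ cov a (map v (iota 0 k)).
Proof.
elim: a v => [|a IH|f IH] v.
- by exists 1%N => -[].
- have [k h] := IH (v \o S); exists k.+1 => /= -[c -> h']; apply: h.
  by rewrite map_comp -(iotaDl 1).
- have [K hK] := choice (fun n => IH n v).
  exists (\max_(n < (v 0%N).+1) K n).+1 => h; have [n nv] : exists2 n, (n <= v 0)%N &
      cov (f n) (map v (iota 0 (\max_(n < (v 0%N).+1) K n).+1)) by exact/cov_OLE.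
  have nv' : (n < (v 0).+1)%N by [].
  have le : (K n <= (\max_(n < (v 0%N).+1) K n).+1)%N.
    by apply: leqW; exact: (leq_bigmax (F := fun i : 'I_(v 0%N).+1 => K i) (Ordinal nv')).
  rewrite -(subnKC le) iotaD map_cat => /cov_catl; exact: hK.
Qed.

(** * Remainders of a partial countdown *)

Fixpoint reach (a : ord) (vs : seq nat) (c : ord) : Prop :=
  match vs with
  | [::] => c = a
  | v :: vs' => exists2 d, down a v d & reach d vs' c
  end.

Lemma cov_reach a vs : cov a vs -> exists c, reach a vs c.
Proof.
elim: vs a => [a _|v vs IH a /= [c d /IH[e h]]]; first by exists a.
by exists e, c.
Qed.

Lemma reach_cat a vs us c : reach a (vs ++ us) c ->
  exists2 d, reach a vs d & reach d us c.
Proof.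
elim: vs a => [|v vs IH] a /=; first by exists a.
by move=> [d h /IH[e h1 h2]]; exists e => //; exists d.
Qed.

Lemma reach_le a vs c : reach a vs c -> ole c a.
Proof.
elim: vs a => [|v vs IH] a /= => [-> //|[d /down_lt/ole_ltW h /IH h']].
exact: ole_trans h' h.
Qed.

Lemma reach_lt a vs c : vs <> [::] -> reach a vs c -> olt c a.
Proof.
by case: vs => [//|v vs] _ /= [d /down_lt h /reach_le h']; apply: ole_lt_trans h.
Qed.

Lemma down_finite a v : exists L : seq ord, forall c, down a v c -> List.In c L.
Proof.
elim: a => [|a _|f IH]; first by exists [::].
  by exists [:: a] => c /= ->; left.
have [L hL] := choice IH.
exists (flatten [seq L n | n <- iota 0 v.+1]) => c [n nv /hL h].
have : n \in iota 0 v.+1 by rewrite mem_iota.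
elim: (iota 0 v.+1) => [//|m s IHs]; rewrite in_cons => /orP[/eqP<-|/IHs h'] /=;
  (apply/List.in_or_app); [by left|by right].
Qed.

Lemma reach_finite a vs : exists L : seq ord, forall c, reach a vs c -> List.In c L.
Proof.
elim: vs a => [|v vs IH] a; first by exists [:: a] => c /= ->; left.
have [D hD] := down_finite a v; have [L hL] := choice IH.
exists (flatten (map L D)) => c /= [d /hD + /hL h].
elim: D {hD} => [//|e D IHD] /= [->|/IHD h'];
  (apply/List.in_or_app); [by left|by right].
Qed.

(** A pigeonhole argument. If a candidate [c] fails at [n0], it lies strictly below [f n0]; whatever
    bounds [f n0] also bounds all that [c] bounds, and [c] can be removed from the list. *)
Lemma common_upper_bound (L : seq ord) (P : ord -> Prop) (f : nat -> ord) :
  (forall n, exists c, [/\ List.In c L, P c & ole (f n) c]) ->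
  exists2 c, P c & forall n, ole (f n) c.
Proof.
elim: L => [/(_ 0%N)[c []]//|c L IH] h.
have [[Pc h']|no] := pselect (P c /\ forall n, ole (f n) c); first by exists c.
have [Pc|nPc] := pselect (P c); last first.
  by apply: IH => n; have [d [[e|i] Pd l]] := h n; [case: nPc; rewrite e|exists d].
have [n0 /oleNgt lt] : exists n0, ~ ole (f n0) c.
  by apply/existsNP => h'; apply: no.
apply: IH => n; have [d [[e|i] Pd l]] := h n; last by exists d.
have [d' [[e'|i'] Pd' l']] := h n0.
  by rewrite -e' in l'; case: (olt_irr (olt_le_trans lt l')).
exists d'; split=> //; apply: ole_trans l'; apply: ole_trans (ole_ltW lt).
by rewrite e.
Qed.

(** * Families of covers on a scale, and their Cantor-Bendixson index *)

Section Families.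
Variable H : nat -> nat.
Hypothesis H_mono : {homo H : v w / (v <= w)%N}.
Hypothesis H_unb : forall n, exists k, (n <= H k)%N.

(** The scale [H] gives later points larger budgets. For [a = omega] and [H] the identity, the
    nonempty members are the sets with at most [min A] elements: the Schreier family. *)
Definition Fam (a : ord) : fam :=
  [set A | exists s, [/\ sorted ltn s, A = [set k | k \in s] & cov a (map H s)]].

Lemma sorted_set_inj (s t : seq nat) : sorted ltn s -> sorted ltn t ->
  [set k | k \in s] = [set k | k \in t] -> s = t.
Proof.
move=> ss st e; apply: (irr_sorted_eq ltn_trans ltnn ss st) => k.
by apply/idP/idP => h; [have : [set k | k \in t] k by rewrite -e|
                        have : [set k | k \in s] k by rewrite e].
Qed.

Lemma Fam_seq a (s : seq nat) : sorted ltn s -> Fam a [set k | k \in s] <-> cov a (map H s).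
Proof.
move=> ss; split=> [[t [st /sorted_set_inj -> //]]|h].
by exists s.
Qed.

Lemma sorted_map_H s : sorted ltn s -> sorted leq (map H s).
Proof. by apply: homo_sorted => x y /ltnW/H_mono. Qed.

Lemma filter_prop_set (P : set nat) (s : seq nat) :
  [set k | k \in [seq k <- s | `[< P k >]]] = P `&` [set k | k \in s].
Proof.
apply/seteqP; split=> k /=; rewrite mem_filter.
  by move=> /andP[/asboolP].
by move=> [/asboolP -> ->].
Qed.

Lemma Fam_hereditary a : hereditary (Fam a).
Proof.
move=> A B [s [ss -> h]] BA; exists [seq k <- s | `[< B k >]]; split.
- exact: sorted_filter ltn_trans _ _ ss.
- by rewrite filter_prop_set; apply/seteqP; split=> k; [move=> Bk; split=> //; exact: BA|case].
- apply: cov_subseq h; first exact: sorted_map_H.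
  exact/map_subseq/filter_subseq.
Qed.

Lemma Fam_spreading a : spreading (Fam a).
Proof.
move=> s t ss st es h; rewrite !Fam_seq //; apply: cov_le.
elim: s t es h {ss st} => [|x s IH] [|y t]//= [es] h.
rewrite H_mono ?(h 0%N) //=; apply: IH => // i; exact: (h i.+1).
Qed.

Lemma sorted_cat_ltn (s t : seq nat) : sorted ltn s -> sorted ltn t ->
  (forall i j, i \in s -> j \in t -> (i < j)%N) -> sorted ltn (s ++ t).
Proof.
move=> ss st h; rewrite (sorted_pairwise ltn_trans) pairwise_cat.
rewrite -!(sorted_pairwise ltn_trans) ss st !andbT; apply/allrelP => i j; exact: h.
Qed.

Lemma sorted_rcons (s : seq nat) k : sorted ltn s ->
  (forall i, i \in s -> (i < k)%N) -> sorted ltn (rcons s k).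
Proof.
move=> ss h; rewrite -cats1; apply: sorted_cat_ltn => // i j si.
by rewrite inE => /eqP ->; exact: h.
Qed.

Lemma sorted_split_at (s : seq nat) n : sorted ltn s ->
  s = [seq x <- s | x < n]%N ++ [seq x <- s | n <= x]%N.
Proof.
move=> ss; apply: (irr_sorted_eq ltn_trans ltnn ss).
  apply: sorted_cat_ltn; try exact: (sorted_filter ltn_trans).
  move=> x y; rewrite !mem_filter => /andP[xn _] /andP[ny _].
  exact: leq_trans xn ny.
by move=> k; rewrite mem_cat !mem_filter ltnNge; case: (_ <= _)%N; rewrite ?orbF.
Qed.

Lemma agree_filter n A (s : seq nat) : sorted ltn s -> agree n A [set k | k \in s] ->
  [seq k <- iota 0 n | `[< A k >]] = [seq k <- s | k < n]%N.
Proof.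
move=> ss ag; apply: (irr_sorted_eq ltn_trans ltnn).
- by apply: (sorted_filter ltn_trans); exact: iota_ltn_sorted.
- exact: (sorted_filter ltn_trans).
- move=> k; rewrite !mem_filter mem_iota /= add0n andbC; case: ltnP => //= kn.
  by apply/asboolP/idP => /(ag _ kn).
Qed.

(** Initial segments of a limit [A] are traces of members, hence covered. A finite [A] is one of
    them; an infinite [A] would have every initial part of its budget sequence covered, against
    [cov_infinite]. *)
Lemma Fam_closed a (A : set nat) : (forall n, exists B, Fam a B /\ agree n A B) -> Fam a A.
Proof.
move=> h; pose s n := [seq k <- iota 0 n | `[< A k >]].
have covs n : cov a (map H (s n)).
  have [B [[t [st -> ht]] ag]] := h n.
  rewrite /s (agree_filter st ag); apply: cov_subseq ht; first exact: sorted_map_H.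
  exact/map_subseq/filter_subseq.
have ss n : sorted ltn (s n).
  by apply: (sorted_filter ltn_trans); exact: iota_ltn_sorted.
have [[n0 hn0]|inf] := pselect (exists n0, forall k, (n0 <= k)%N -> ~ A k).
  exists (s n0); split=> //; rewrite filter_prop_set; apply/seteqP; split=> k; last by case.
  move=> Ak; split=> //=; rewrite mem_iota /= add0n ltnNge; apply/negP => /hn0; exact.
have {}inf n : exists2 k, (n <= k)%N & A k.
  apply: contrapT => no; apply: inf; exists n => k nk Ak; apply: no; by exists k.
have scat n m : (n <= m)%N -> exists r, s m = s n ++ r.
  move=> /subnKC<-; rewrite /s iotaD filter_cat; by eexists.
have big K : exists n, (K <= size (s n))%N.
  elim: K => [|K [n hn]]; first by exists 0%N.
  have [k nk Ak] := inf n; exists k.+1.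
  have [r e] := scat _ _ nk; rewrite /s -[in iota 0 _]addn1 iotaD filter_cat /= add0n -/(s k) e.
  by rewrite (asboolT Ak) !size_cat /= addn1 ltnS (leq_trans hn) // leq_addr.
have [nn hnn] := choice (fun k => big k.+1).
pose v k := H (nth 0%N (s (nn k)) k).
have [k []] := cov_infinite a v.
have [n hn] := big k; have := covs n; rewrite -(cat_take_drop k (s n)) map_cat => /cov_catl.
suff -> : map v (iota 0 k) = map H (take k (s n)) by [].
apply: (@eq_from_nth _ 0%N); rewrite !size_map size_iota ?size_takel // => i ik.
rewrite !(nth_map 0%N) ?size_iota ?size_takel // nth_iota // add0n nth_take // /v; congr H.
have := hnn i => hi; have := leq_trans ik hn => hi'.
have [nm|/ltnW nm] := leqP n (nn i).
  by have [r ->] := scat _ _ nm; rewrite nth_cat hi'.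
by have [r ->] := scat _ _ nm; rewrite nth_cat hi.
Qed.

Lemma Fam_regular a : regular (Fam a).
Proof.
split; first exact: Fam_hereditary.
split; first exact: Fam_spreading.
split=> [A [s [_ -> _]]|A]; last exact: Fam_closed.
exact: finite_seq.
Qed.

Lemma oderiv_sub a b : oderiv (Fam a) b `<=` Fam a.
Proof.
elim: b => [//|b IH|f IH] A /=; last by move=> /(_ 0%N)/IH.
move=> h; apply: Fam_closed => n; have [B [/IH FB [_ ag]]] := h n.
by exists B.
Qed.

(** The set [l] survives [c] derivations if all [c]-covers with large entries can be appended to it.
    The threshold [k0] is what a limit needs: branch [n] becomes available once all entries are at
    least [n]. *)
Lemma oderiv_lower a c l : sorted ltn l ->
  (exists k0, forall us, all (leq k0) us -> cov c us -> cov a (map H l ++ us)) ->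
  oderiv (Fam a) c [set k | k \in l].
Proof.
elim: c l => [|c IH|f IH] l sl [k0 h] /=.
- by exists l; split=> //; have := h [::]; rewrite cats0; apply.
- move=> n; have [k1 hk1] := H_unb k0.
  pose k := maxn (maxn n k1) (\max_(i <- l) i).+1.
  have lk i : i \in l -> (i < k)%N.
    move=> il; rewrite /k leq_max; apply/orP; right; rewrite ltnS.
    by rewrite (big_rem i) //= leq_maxl.
  exists [set i | i \in rcons l k]; split; [|split].
  + apply: IH.
      exact: sorted_rcons.
    exists k0 => us hus cus; rewrite map_rcons cat_rcons; apply: h.
      rewrite /= hus andbT; apply: leq_trans hk1 (H_mono _).
      by rewrite /k !leq_max leqnn orbT.
    by exists c.
  + move=> /(congr1 (fun A => A k)) /=; rewrite mem_rcons mem_head => e.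
    by have := lk k; rewrite -e ltnn => /(_ isT).
  + move=> i ik /=; rewrite mem_rcons in_cons.
    have -> // : i == k = false.
    by apply/negbTE; rewrite neq_ltn (leq_trans ik) // /k !leq_max leqnn.
- move=> n; apply: IH => //; exists (maxn k0 n) => us hus cus; apply: h.
    by apply: sub_all hus => w; rewrite geq_max => /andP[].
  case: us cus hus => [//|u us] cus /= /andP[]; rewrite geq_max => /andP[_ nu] _.
  by apply/cov_OLE; exists n.
Qed.

(** Each derivation exhibits a proper end-extension of the same set, which uses up at least one step
    of the countdown. At a limit every [f n] brings its own remainder, but only finitely many
    remainders are reachable along [l], so one of them bounds all [f n]. *)
Lemma oderiv_upper a b A : oderiv (Fam a) b A ->
  exists l c, [/\ sorted ltn l, A = [set k | k \in l], reach a (map H l) c & ole b c].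
Proof.
elim: b A => [|b IH|f IH] A.
- move=> [s [ss -> /cov_reach[c h]]]; exists s, c; split=> //; exact: ole_Z.
- move=> h; have [l [sl eA _]] := oderiv_sub h; move: h; rewrite eA => h.
  pose n := (\max_(i <- l) i).+1.
  have ln i : i \in l -> (i < n)%N.
    by move=> il; rewrite /n ltnS (big_rem i) //= leq_maxl.
  have [B [/IH[l' [c [sl' eB r bc]]] [BA ag]]] := h n.
  have el : l = [seq k <- l' | k < n]%N.
    rewrite eB in ag; apply: (irr_sorted_eq ltn_trans ltnn sl).
      exact: (sorted_filter ltn_trans).
    move=> k; rewrite mem_filter; apply/idP/andP => [kl|[kn kl']].
      by split; [exact: ln|apply/(ag k (ln _ kl))].
    exact/(ag k kn).
  move: r; rewrite (sorted_split_at n sl') -el map_cat => /reach_cat[d r1 r2].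
  exists l, d; split=> //; apply/ole_SE; apply: ole_lt_trans bc _.
  apply: reach_lt r2; case E : [seq x <- l' | n <= x]%N => [|//].
  by case: BA; rewrite eB (sorted_split_at n sl') -el E cats0.
- move=> h; have [l [sl eA _]] := @oderiv_sub a (OL f) _ h.
  have [L hL] := reach_finite a (map H l).
  have [n|c r hc] := @common_upper_bound L (reach a (map H l)) f.
    have [l' [c [sl' eA' r lc]]] := IH n A (h n).
    have e : l' = l by apply: sorted_set_inj => //; rewrite -eA -eA'.
    by rewrite e in r; exists c; split=> //; exact: hL.
  by exists l, c; split=> //; exact/ole_LE.
Qed.

Lemma Fam_CB_index a : CB_index (Fam a) a.
Proof.
apply/seteqP; split=> [A /oderiv_upper[l [c [sl -> r ac]]]|A /= ->].
  case: l sl r => [_ _|x l sl r]; first by apply/seteqP; split.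
  by case: (@olt_irr a); apply: ole_lt_trans ac _; apply: reach_lt r.
have -> : set0 = [set k | k \in ([::] : seq nat)] by apply/seteqP; split.
by apply: oderiv_lower => //; exists 0%N.
Qed.

End Families.

(** * Averages along a tree *)

Lemma ler_sum_subset (R : realType) (w : nat -> R) (B C : seq nat) :
  (forall i, 0 <= w i) -> uniq B -> uniq C -> {subset B <= C} ->
  \sum_(i <- B) w i <= \sum_(i <- C) w i.
Proof.
move=> w0 uB uC BC; rewrite [leRHS](bigID (mem B)) /= -[X in _ <= X + _]big_filter.
rewrite (perm_big [seq i <- C | i \in B]) ?lerDl ?sumr_ge0 //.
apply: uniq_perm => //; first exact: filter_uniq.
by move=> i; rewrite mem_filter; case: (boolP (i \in B)) => //= /BC ->.
Qed.

Lemma sum_filter_supp (R : realType) (w : nat -> R) (B : seq nat) (P : pred nat) :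
  (forall i, ~~ P i -> w i = 0) -> \sum_(i <- B) w i = \sum_(i <- [seq i <- B | P i]) w i.
Proof.
by move=> h; rewrite big_filter (bigID P) /= [X in _ + X]big1 ?addr0 // => i /h.
Qed.

Section TreeDerivatives.
Variable R : realType.
Variable T : set (seq (nat -> R)).
Hypothesis T_take : forall s n, T s -> (0 < n)%N -> T (take n s).

Lemma tderiv_sub b : tderiv T b `<=` T.
Proof.
by elim: b => [//|b IH s [/IH]//|f IH s /(_ 0%N)/IH].
Qed.

Lemma tD_mono (S S' : set (seq (nat -> R))) : S `<=` S' -> tD S `<=` tD S'.
Proof. by move=> h s [/h Ss [t [/h St r]]]; split=> //; exists t. Qed.

Lemma tderiv_le a b : ole a b -> tderiv T b `<=` tderiv T a.
Proof.
suff H : (forall a b, ole a b -> tderiv T b `<=` tderiv T a) /\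
         (forall a b, olt a b -> tderiv T b `<=` tderiv T (OS a)) by exact: H.1.
apply: ole_olt_ind => [{}b|//|f {}b _ IH|{}a {}b _|{}a g n _ IH].
- exact: tderiv_sub.
- by move=> s h n; apply: IH.
- exact: tD_mono.
- by move=> s /(_ n)/IH.
Qed.

Lemma tderiv_take b s n : tderiv T b s -> (0 < n)%N -> tderiv T b (take n s).
Proof.
elim: b s n => [|b IH|f IH] s n; first exact: T_take.
- move=> [hs [t [ht [st e]]]] n0; split; first exact: IH.
  exists t; split=> //; rewrite size_take_min; split.
    by apply: leq_ltn_trans st; exact: geq_minr.
  by rewrite take_min e.
- by move=> h n0 k; apply: IH.
Qed.

Lemma tderiv_rcons b s : tderiv T (OS b) s -> exists y, tderiv T b (rcons s y).
Proof.
move=> [_ [t [ht [st e]]]]; exists (nth (fun=> 0) t (size s)).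
have -> : rcons s (nth (fun=> 0) t (size s)) = take (size s).+1 t.
  by rewrite (take_nth (fun=> 0)) // e.
exact: tderiv_take.
Qed.

Definition prefix_mono (be : seq (nat -> R) -> nat) := forall s u, (be s <= be (s ++ u))%N.

(** The budget of a position depends only on the vectors up to and including it, so it is unaffected
    when the node is extended. *)
Definition budget (be : seq (nat -> R) -> nat) t i := be (take i.+1 t).

Lemma budget_le be t i j : prefix_mono be -> (i <= j)%N -> (budget be t i <= budget be t j)%N.
Proof.
move=> m ij; rewrite /budget; have -> : take j.+1 t = take i.+1 t ++ take (j - i) (drop i.+1 t).
  by rewrite -takeD addSn subnKC.
exact: m.
Qed.

Lemma budget_cat be s u i : (i < size s)%N -> budget be (s ++ u) i = budget be s i.
Proof.
move=> h; rewrite /budget; congr be; rewrite take_cat.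
by case: ltnP => // h'; rewrite (_ : i.+1 = size s) ?subnn ?take0 ?cats0 ?take_size //; apply/eqP; rewrite eqn_leq h.
Qed.

Lemma budget_ge be s u i : prefix_mono be -> (size s <= i)%N ->
  (be s <= budget be (s ++ u) i)%N.
Proof. by move=> m h; rewrite /budget take_cat ltnNge (leqW h); exact: m. Qed.

Lemma budget_le_all be t i : prefix_mono be -> (budget be t i <= be t)%N.
Proof. by move=> m; rewrite -{2}(cat_take_drop i.+1 t); exact: m. Qed.

Lemma sorted_budget be t B : prefix_mono be -> sorted ltn B ->
  sorted leq (map (budget be t) B).
Proof. by move=> m; apply: homo_sorted => i j /ltnW; exact: budget_le. Qed.

Lemma weight_omulfin (w : nat -> R) e a (f : nat -> nat) n B :
  (forall B', subseq B' B -> cov a (map f B') -> \sum_(i <- B') w i <= e) ->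
  cov (omul a (ofin n)) (map f B) -> \sum_(i <- B) w i <= n%:R * e.
Proof.
elim: n B => [|n IH] B h /=.
  by case: B h => [_ _|i B _ []//]; rewrite big_nil mul0r.
move=> /cov_oadd[us [ws [e1 h1 h2]]].
rewrite -(cat_take_drop (size us) B) big_cat /= -natr1 mulrDl mul1r addrC.
have e2 : map f (take (size us) B) = us by rewrite map_take e1 take_size_cat.
have e3 : map f (drop (size us) B) = ws by rewrite map_drop e1 drop_size_cat.
apply: lerD.
  apply: IH; rewrite ?e3 // => B' s; apply: h; apply: subseq_trans s _.
  exact: drop_subseq.
by apply: h; rewrite ?e2 //; exact: take_subseq.
Qed.

(** * Spreading mass along a branch against all covers *)

Definition mass_on (w : nat -> R) (m n : nat) (r : R) :=
  [/\ forall i, 0 <= w i, forall i, ~~ (m <= i < n)%N -> w i = 0 &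
      \sum_(0 <= i < n) w i = r].

Lemma mass_on_sum w m n r B : mass_on w m n r -> uniq B -> \sum_(i <- B) w i <= r.
Proof.
move=> [w0 ws <-] uB; rewrite (sum_filter_supp B ws).
apply: ler_sum_subset => //; rewrite ?filter_uniq ?iota_uniq //.
by move=> i; rewrite mem_filter mem_index_iota => /andP[/andP[_ ->] _].
Qed.

Lemma mass_onD w1 w2 m n p r1 r2 : (m <= n <= p)%N -> mass_on w1 m n r1 -> mass_on w2 n p r2 ->
  mass_on (fun i => w1 i + w2 i) m p (r1 + r2).
Proof.
move=> /andP[mn np] [a1 a2 a3] [b1 b2 b3]; split.
- by move=> i; rewrite addr_ge0.
- move=> i h; rewrite a2 ?b2 ?addr0 //; apply: contra h => /andP[h1 h2].
    by rewrite h2 (leq_trans mn).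
  by rewrite h1 (leq_trans h2).
- rewrite big_split /= b3; congr (_ + _); rewrite -a3 (big_cat_nat _ (n := n)) //=.
  rewrite [X in _ + X]big_nat_cond [X in _ + X]big1 ?addr0 // => i /andP[/andP[h _] _].
  by rewrite a2 // negb_and -!leqNgt h orbT.
Qed.

(* The entry [be s] in front: once a prefix [s] is fixed, a cover that has already spent
   one of its choices on [s] catches only a small part of the next block. *)
Definition group_lemma g := forall be (e : R) b s, prefix_mono be -> 0 < e ->
  tderiv T (oadd b (oexp omega g)) s ->
  exists u w, [/\ tderiv T b (s ++ u), mass_on w (size s) (size (s ++ u)) 1 &
    forall B, sorted ltn B -> all (leq (size s)) B ->
      cov (oexp omega g) (be s :: map (budget be (s ++ u)) B) -> \sum_(i <- B) w i <= e].

(** Compared with [group_lemma], the factor [N] in the order removes the need for an entry spent in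
    front; [N] depends only on [be] and [e], not on the node. *)
Definition average_lemma g := forall be (e : R), prefix_mono be -> 0 < e ->
  exists N, forall b s, tderiv T (oadd b (omul (oexp omega g) (ofin N))) s ->
  exists u w, [/\ tderiv T b (s ++ u), mass_on w (size s) (size (s ++ u)) 1 &
    forall B, sorted ltn B ->
      cov (oexp omega g) (map (budget be (s ++ u)) B) -> \sum_(i <- B) w i <= e].

(** A cover pays the full mass 1 only in the first group that it meets. On every later group it has
    already spent an entry, so it catches at most [d]. *)
Lemma group_iter g be (d : R) r b s : group_lemma g -> prefix_mono be -> 0 < d ->
  tderiv T (oadd b (omul (oexp omega g) (ofin r))) s ->
  exists u w, [/\ tderiv T b (s ++ u), mass_on w (size s) (size (s ++ u)) r%:R &
    forall B, sorted ltn B ->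
      cov (oexp omega g) (map (budget be (s ++ u)) B) -> \sum_(i <- B) w i <= 1 + r%:R * d].
Proof.
move=> grp m d0; elim: r b s => [|r IH] b s.
  move=> h; exists [::], (fun=> 0); rewrite cats0; split=> //.
    by split=> //; rewrite big1.
  by move=> B _ _; rewrite big1 // mul0r addr0.
(* The order is used up from the right, so writing [1 + r] reserves one copy of omega^g for the last
   group. *)
rewrite -[r.+1]add1n ofinD omulDr /= oadd0o oaddA => /IH[u [w [h1 mw h2]]].
have [u' [w' [h1' mw' h2']]] := grp be d _ _ m d0 h1.
exists (u ++ u'), (fun i => w i + w' i); rewrite catA; split=> //.
  rewrite natrD addrC; apply: mass_onD mw mw'.
  by rewrite !size_cat leq_addr leq_addr.
move=> B sB cB; rewrite big_split /=.
rewrite (sum_filter_supp B (P := fun i => i < size (s ++ u))%N); last first.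
  by move=> i hi; case: mw => _ z _; apply: z; apply: contra hi => /andP[_ ->].
rewrite [X in _ + X](sum_filter_supp B (P := fun i => size (s ++ u) <= i)%N); last first.
  by move=> i hi; case: mw' => _ z _; apply: z; apply: contra hi => /andP[-> _].
move: cB; rewrite {1}(sorted_split_at (size (s ++ u)) sB).
set B1 := [seq i <- B | _ < _]%N; set B2 := [seq i <- B | _ <= _]%N => cB.
have sB1 : sorted ltn B1 by exact: (sorted_filter ltn_trans).
have sB2 : sorted ltn B2 by exact: (sorted_filter ltn_trans).
have aB2 : all (leq (size (s ++ u))) B2 by exact: filter_all.
have le1 : \sum_(i <- B1) w i <= 1 + r%:R * d.
  apply: h2 => //; move: cB; rewrite map_cat => /cov_catl.
  rewrite (_ : map (budget be (s ++ u)) B1 = map (budget be ((s ++ u) ++ u')) B1) //.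
  apply/eq_in_map => i; rewrite mem_filter => /andP[hi _]; by rewrite [RHS]budget_cat.
rewrite add1n -natr1 mulrDl mul1r addrA.
(* If the cover misses the earlier groups, the new one is the first that it meets. Otherwise its
   entry [i], of budget at most [be (s ++ u)], plays the entry in front. *)
case E : B1 cB le1 => [|i B1'] cB le1.
  rewrite big_nil add0r; apply: le_trans (mass_on_sum mw' _) _.
    exact: sorted_uniq ltn_trans ltnn _ sB2.
  have := mulr_ge0 (ler0n R r) (ltW d0); lra.
apply: lerD => //; apply: h2' => //.
have /cov_subseq/(_ cB) : subseq (budget be ((s ++ u) ++ u') i :: map (budget be ((s ++ u) ++ u')) B2)
    (map (budget be ((s ++ u) ++ u')) ((i :: B1') ++ B2)).
  by rewrite /= eqxx map_cat suffix_subseq // suffix_suffix.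
rewrite -E -(sorted_split_at _ sB) => /(_ (sorted_budget _ m sB)).
apply: cov_le => /=; apply/andP; split.
  have iB : i \in B1 by rewrite E mem_head.
  move: iB; rewrite mem_filter => /andP[hi _].
  by rewrite (@budget_cat _ (s ++ u)) //; exact: budget_le_all.
exact: all2_map_leq.
Qed.

(** With [N] groups and [d = 1 / N] a cover catches at most [1 + N * d = 2]; dividing the masses by
    [N] leaves [2 / N], which is below [e]. *)
Lemma group_average g : group_lemma g -> average_lemma g.
Proof.
move=> grp be e m e0.
have [N hN] : exists N, 2 / e < N.+1%:R.
  exists (Num.truncn (2 / e)); apply: truncnS_gt.
have N0 : 0 < N.+1%:R :> R by rewrite ltr0n.
exists N.+1 => b s h.
have [|u [w [h1 [w0 ws w1] h2]]] := @group_iter g be (N.+1%:R^-1) N.+1 b s grp m _ h.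
  by rewrite invr_gt0.
exists u, (fun i => w i / N.+1%:R); split=> //.
  split=> [i|i /ws ->|]; first by rewrite divr_ge0 // ltW.
    by rewrite mul0r.
  by rewrite -mulr_suml w1 divff // gt_eqF.
move=> B sB /(h2 _ sB); rewrite -mulr_suml divff ?gt_eqF // => h3.
rewrite ler_pdivrMr //; apply: le_trans h3 _.
by move: hN; rewrite ltr_pdivrMr // mulrC => /ltW; lra.
Qed.

(** Induction on [g]: the entry [be s] in front, known before the group is built, resolves omega^g
    to a smaller ordinal, against which averages of lower order suffice. *)
Lemma group_lemma_holds g : group_lemma g.
Proof.
elim: g => [|g IH|f IH] be e b s m e0.
- move=> /tderiv_rcons[y h]; exists [:: y], (fun i => (i == size s)%:R).
  rewrite cats1; split=> //.
    rewrite size_rcons; split=> [i|i|]; first exact: ler0n.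
      by case: eqP => // ->; rewrite leqnn ltnS leqnn.
    rewrite big_nat_recr //= eqxx big_nat big1 ?add0r // => i /= h'.
    by rewrite ltn_eqF.
  (* From omega^0 = 1 the entry in front spends everything, so [B] is empty. *)
  by move=> [|i B] _ _; [rewrite big_nil ltW|move=> /= [c -> []]].
- have v0 : 0 < (be s).+1%:R :> R by rewrite ltr0n.
  (* The entry in front leaves [n] copies of omega^g with [n <= be s], and each of them may catch
     [e / (be s + 1)]. *)
  have [|N hN] := group_average IH (e := e / (be s).+1%:R) m; first by rewrite divr_gt0.
  move=> h; have [u [w [h1 mw h2]]] := hN b s (h N); exists u, w; split=> //.
  move=> B sB aB /cov_OLE[n nv /(cov_subseq (us := map (budget be (s ++ u)) B))].
  rewrite subseq_cons => /(_ _ isT) cB.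
  have {}cB := cB _.
  have sl : sorted leq (be s :: map (budget be (s ++ u)) B).
    rewrite /= path_sortedE; last exact: leq_trans.
    rewrite sorted_budget // andbT all_map; apply: sub_all aB => i; exact: budget_ge.
  have {}cB := cB sl.
  apply: le_trans (weight_omulfin (e := e / (be s).+1%:R) _ cB) _.
    move=> B' sB'; apply: h2; exact: subseq_sorted ltn_trans _ _ sB' sB.
  rewrite mulrA ler_pdivrMr // mulrC ler_pM2l // ler_nat; exact: leqW.
- move=> h; have sl u B : all (leq (size s)) B -> sorted ltn B ->
      sorted leq (be s :: map (budget be (s ++ u)) B).
    move=> aB sB; rewrite /= path_sortedE; last exact: leq_trans.
    rewrite sorted_budget // andbT all_map; apply: sub_all aB => i; exact: budget_ge.
  (* A limit tree may attain its supremum at a branch; domination then reduces the claim to that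
     branch. *)
  have [[n hn]|na] := pselect (exists n, ole (OL f) (f n)).
    have [psi pm dom] := ole_dominates (oexp_le hn).
    have [|u [w [h1 mw h2]]] := IH n (psi \o be) e b s _ e0 (h n).
      by move=> s' u'; exact/pm/m.
    exists u, w; split=> // B sB aB cB; apply: h2 => //.
    have := dom _ (sl u B aB sB) cB; rewrite /= -map_comp; apply.
  (* All branches open to the entry in front are dominated by [f n], and a strictly larger [f k] has
     room for the [N] copies of omega^(f n) that an average needs. *)
  have [n nv hmax] := ole_max_below f (be s).
  have [k hk] : exists k, olt (f n) (f k).
    apply: contrapT => no; apply: na; exists n; apply/ole_LE => k.
    by case: (ole_olt_total (f k) (f n)).1 => // lt; case: no; exists k.
  have /choice[p hp] : forall i, exists q, {homo q : v w / (v <= w)%N} /\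
      ((i <= be s)%N -> dominates q (oexp omega (f i)) (oexp omega (f n))).
    move=> i; case: (leqP i (be s)) => [ile|_]; last by exists (fun x => x); split.
    by have [q ? ?] := ole_dominates (oexp_le (hmax i ile)); exists q.
  pose psi w := (\max_(i < (be s).+1) p i w)%N.
  have [|N hN] := group_average (IH n) (be := psi \o be) (e := e) _ e0.
    move=> s' u'; apply/bigmax_leqP => i _; apply: leq_trans (leq_bigmax i).
    by apply: (hp i).1; exact: m.
  have [|u [w [h1 mw h2]]] := hN b s _.
    move: (h k) => /=; apply: tderiv_le; apply: oadd_le2l.
    apply: ole_trans (ole_ltW (oexp_mulfin_lt _ _)) _.
    by apply: oexp_le; exact/ole_SE.
  exists u, w; split=> // B sB aB /cov_OLE[i iv ci]; apply: h2 => //.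
  have {}ci : cov (oexp omega (f i)) (map (budget be (s ++ u)) B).
    by apply: cov_subseq ci; [exact: sl|exact: subseq_cons].
  have := (hp i).2 iv _ (sorted_budget _ m sB) ci; rewrite -map_comp; apply: cov_le.
  apply: all2_map_leq => j _ /=; have iv' : (i < (be s).+1)%N by [].
  exact: (leq_bigmax (F := fun i : 'I_(be s).+1 => p i _) (Ordinal iv')).
Qed.

Lemma average_lemma_holds g : average_lemma g.
Proof. exact/group_average/group_lemma_holds. Qed.

End TreeDerivatives.

(** * The mixed Tsirelson norm *)

Section NormLemmas.
Variable R : realType.
Implicit Types (x y z : nat -> R) (E : set nat) (Es : seq (set nat)).

Definition vanishes_from n x := forall k, (n <= k)%N -> x k = 0.
Definition l1 n x := \sum_(0 <= k < n) `|x k|.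

Lemma vanishes_c00 x : c00 x -> exists n, vanishes_from n x.
Proof.
move=> /finite_seqP[s e]; exists (\max_(k <- s) k).+1%N => k hk.
apply/eqP; apply: contraTT hk => xk; rewrite -ltnNge ltnS.
have : [set k | x k != 0] k by [].
by rewrite e /= => ks; rewrite (big_rem k) //= leq_maxl.
Qed.

Lemma c00_vanishes n x : vanishes_from n x -> c00 x.
Proof.
move=> h; apply: (sub_finite_set (B := `I_n)); last exact: finite_II.
move=> k /=; apply: contraNT; rewrite -leqNgt => /h ->; exact/eqP.
Qed.

Lemma vanishes_restr n x E : vanishes_from n x -> vanishes_from n (restr E x).
Proof. by move=> h k /h hk; rewrite /restr hk; case: ifP. Qed.

Lemma sum_seq_l1 n x (s : seq nat) : vanishes_from n x -> uniq s ->
  \sum_(k <- s) `|x k| <= l1 n x.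
Proof.
move=> h us; rewrite (sum_filter_supp s (P := fun k => k < n)%N); last first.
  by move=> k; rewrite -leqNgt => /h ->; rewrite normr0.
apply: (@ler_sum_subset R (fun k => `|x k|)) => //; rewrite ?filter_uniq ?iota_uniq //.
by move=> k; rewrite mem_filter mem_index_iota => /andP[].
Qed.

Lemma coord_l1 n x k : vanishes_from n x -> `|x k| <= l1 n x.
Proof. by move=> h; have := @sum_seq_l1 n x [:: k] h; rewrite big_seq1; apply. Qed.

Lemma l1_ge0 n x : 0 <= l1 n x.
Proof. by apply: sumr_ge0. Qed.

Definition successive Es := forall i j, (i < j < size Es)%N -> forall a b,
  nth set0 Es i a -> nth set0 Es j b -> (a < b)%N.

Lemma sum_restr_le Es x k : successive Es ->
  \sum_(E <- Es) `|restr E x k| <= `|x k|.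
Proof.
move=> sE; rewrite (big_nth set0) big_mkord.
have [[i hi]|no] := pselect (exists i : 'I_(size Es), nth set0 Es i k); last first.
  rewrite big1 // => i _; rewrite /restr memNset ?normr0 // => h; by apply: no; exists i.
rewrite (bigD1 i) //= big1 ?addr0.
  by rewrite /restr; case: ifP => //; rewrite normr0.
move=> j ji; rewrite /restr memNset ?normr0 // => hj.
have [ij|ij|/val_inj e] := ltngtP i j; last by rewrite e eqxx in ji.
  by have := sE i j; rewrite ij ltn_ord => /(_ isT k k hi hj); rewrite ltnn.
by have := sE j i; rewrite ij ltn_ord => /(_ isT k k hj hi); rewrite ltnn.
Qed.

Lemma sum_l1_restr n x Es : successive Es ->
  \sum_(E <- Es) l1 n (restr E x) <= l1 n x.
Proof.
move=> sE; rewrite /l1 exchange_big /=; apply: ler_sum => k _.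
exact: sum_restr_le.
Qed.

(** For increasing sequences a finite sum of suprema is the supremum of the sums. This carries
    estimates from the iterates of the norm to their limit. *)
Lemma sum_sup_le (I : Type) (r : seq I) (F : I -> nat -> R) (b : R) :
  (forall i p q, (p <= q)%N -> F i p <= F i q) ->
  (forall p, \sum_(i <- r) F i p <= b) ->
  \sum_(i <- r) sup (range (F i)) <= b.
Proof.
move=> Fm; elim: r b => [|i r IH] b h.
  by rewrite big_nil; have := h 0%N; rewrite big_nil.
rewrite big_cons -lerBrDr; apply: ge_sup; first by exists (F i 0%N), 0%N.
move=> _ [p _ <-]; rewrite lerBrDr addrC -lerBrDr; apply: IH => q.
rewrite lerBrDr addrC; apply: le_trans (h (maxn p q)); rewrite big_cons.
apply: lerD; first exact/Fm/leq_maxl.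
by apply: ler_sum => j _; exact/Fm/leq_maxr.
Qed.

Variables (F0 : fam) (Fs : nat -> fam) (theta : nat -> R).
Hypothesis F0_fin : forall A, F0 A -> finite_set A.
Hypothesis F0_0 : F0 set0.
Hypothesis Fs_0 : forall m, (0 < m)%N -> Fs m set0.
Hypothesis theta01 : forall m, (0 < m)%N -> 0 < theta m < 1.

Let theta0 m : (0 < m)%N -> 0 <= theta m.
Proof. by move=> /theta01/andP[/ltW]. Qed.

Let Nit := Tnorm_it F0 Fs theta.
Let N := Tnorm F0 Fs theta.

Lemma adm_nil m : (0 < m)%N -> admissible (Fs m) [::].
Proof.
move=> m0; split; [|split] => //; first by move=> i j /andP[].
rewrite (_ : [set _ | _] = set0); first exact: Fs_0.
by apply/seteqP; split=> k //= [i []].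
Qed.

Lemma normF_setE n x : vanishes_from n x ->
  has_ubound [set t | exists A, F0 A /\ t = \sum_(k \in A) `|x k|].
Proof.
move=> h; exists (l1 n x) => t [A [/F0_fin/finite_seqP[s ->] ->]].
have -> : [set` s] = [set` undup s].
  by apply/seteqP; split=> k /=; rewrite mem_undup.
by rewrite -fsbig_seq ?undup_uniq //; apply: sum_seq_l1; rewrite ?undup_uniq.
Qed.

Lemma normF_ne x : [set t | exists A, F0 A /\ t = \sum_(k \in A) `|x k|] !=set0.
Proof. by exists 0, set0; split=> //; rewrite fsbig_set0. Qed.

Lemma normF_l1 n x : vanishes_from n x -> normF F0 x <= l1 n x.
Proof.
move=> h; apply: ge_sup (normF_ne x) _ => t [A [/F0_fin/finite_seqP[s ->] ->]].
have -> : [set` s] = [set` undup s].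
  by apply/seteqP; split=> k /=; rewrite mem_undup.
by rewrite -fsbig_seq ?undup_uniq //; apply: sum_seq_l1; rewrite ?undup_uniq.
Qed.

Lemma supnorm_ub n x : vanishes_from n x -> has_ubound (range (fun k => `|x k|)).
Proof. by move=> h; exists (l1 n x) => _ [k _ <-]; exact: coord_l1. Qed.

Lemma supnorm_le x b : (forall k, `|x k| <= b) -> supnorm x <= b.
Proof.
by move=> h; apply: ge_sup => [|_ [k _ <-]//]; exists `|x 0%N|, 0%N.
Qed.

Lemma coord_supnorm n x k : vanishes_from n x -> `|x k| <= supnorm x.
Proof. by move=> h; apply: (ub_le_sup (supnorm_ub h)); exists k. Qed.

Lemma supnorm_ge0 n x : vanishes_from n x -> 0 <= supnorm x.
Proof. by move=> h; apply: le_trans (coord_supnorm 0%N h). Qed.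

Definition Tstep_set (M : (nat -> R) -> R) x : set R :=
  [set t | exists n Es, (0 < n)%N /\ admissible (Fs n) Es /\
                  t = theta n * \sum_(E <- Es) M (restr E x)].

Lemma Tstep_ne M x : Tstep_set M x !=set0.
Proof. by exists (theta 1%N * \sum_(E <- [::]) M (restr E x)), 1%N, [::]; split=> //; split=> //; exact: adm_nil. Qed.

Lemma theta_sum_le m (Es : seq (set nat)) (M : set nat -> R) b : (0 < m)%N ->
  (forall E, 0 <= M E) -> \sum_(E <- Es) M E <= b -> theta m * \sum_(E <- Es) M E <= b.
Proof.
move=> m0 M0; apply: le_trans; rewrite ler_piMl ?sumr_ge0 //.
by case/andP: (theta01 m0) => _ /ltW.
Qed.

Lemma Nit_bound p n x : vanishes_from n x -> 0 <= Nit p x <= l1 n x.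
Proof.
elim: p x => [|p IH] x h /=.
  rewrite le_max (supnorm_ge0 h) /= ge_max normF_l1 // andbT.
  by apply: supnorm_le => k; exact: coord_l1.
case/andP: (IH _ h) => h1 h2; rewrite le_max h1 /= !ge_max h2 normF_l1 //=.
apply: ge_sup (Tstep_ne _ _) _ => _ [m [Es [m0 [[_ [sE _]] ->]]]].
have hb E : 0 <= Nit p (restr E x) <= l1 n (restr E x) by apply: IH; exact: vanishes_restr.
apply: (theta_sum_le (M := fun E => Nit p (restr E x))) => //.
  by move=> E; case/andP: (hb E).
apply: le_trans (sum_l1_restr n x sE); apply: ler_sum => E _.
by case/andP: (hb E).
Qed.

Lemma Nit_ge0 p n x : vanishes_from n x -> 0 <= Nit p x.
Proof. by move=> h; case/andP: (Nit_bound p h). Qed.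

Lemma Tstep_ub p n x : vanishes_from n x -> has_ubound (Tstep_set (Nit p) x).
Proof.
move=> h; exists (l1 n x) => _ [m [Es [m0 [[_ [sE _]] ->]]]].
apply: (theta_sum_le (M := fun E => Nit p (restr E x))) => //.
  by move=> E; exact: (Nit_ge0 p (vanishes_restr E h)).
apply: le_trans (sum_l1_restr n x sE); apply: ler_sum => E _.
by case/andP: (Nit_bound p (vanishes_restr E h)).
Qed.

Lemma normF_seq n x (s : seq nat) : vanishes_from n x -> uniq s -> F0 [set k | k \in s] ->
  \sum_(k <- s) `|x k| <= normF F0 x.
Proof.
move=> h us Fs'; apply: (ub_le_sup (normF_setE h)); exists [set k | k \in s]; split=> //.
by rewrite -fsbig_seq.
Qed.

Lemma normF_le x b : (forall s : seq nat, sorted ltn s -> F0 [set k | k \in s] ->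
  \sum_(k <- s) `|x k| <= b) -> normF F0 x <= b.
Proof.
move=> h; apply: ge_sup (normF_ne x) _ => _ [A [FA ->]].
have /finite_seqP[s eA] := F0_fin FA.
pose t := sort leq (undup s).
have eA' : A = [set k | k \in t].
  by rewrite eA; apply/seteqP; split=> k /=; rewrite mem_sort mem_undup.
have st : sorted ltn t.
  by rewrite ltn_sorted_uniq_leq sort_uniq undup_uniq sort_sorted //; exact: leq_total.
rewrite eA' -fsbig_seq; last exact: sorted_uniq ltn_trans ltnn _ st.
by apply: h; rewrite -?eA'.
Qed.

Lemma normF_dom n (a b : R) x y z : 0 <= a -> 0 <= b ->
  vanishes_from n x -> vanishes_from n y ->
  (forall k, `|z k| <= a * `|x k| + b * `|y k|) ->
  normF F0 z <= a * normF F0 x + b * normF F0 y.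
Proof.
move=> a0 b0 vx vy hz; apply: normF_le => s ss Fs'.
apply: le_trans (ler_sum _ (fun k _ => hz k)) _; rewrite big_split /= -!mulr_sumr.
have us := sorted_uniq ltn_trans ltnn ss.
by apply: lerD; apply: ler_wpM2l => //; apply: normF_seq Fs'; eassumption.
Qed.

(** Monotonicity in absolute values, homogeneity and the triangle inequality in one statement. The
    coordinatewise hypothesis passes to restrictions, so the induction over the iterates closes. *)
Lemma Nit_dom p n (a b : R) x y z : 0 <= a -> 0 <= b ->
  vanishes_from n x -> vanishes_from n y ->
  (forall k, `|z k| <= a * `|x k| + b * `|y k|) ->
  Nit p z <= a * Nit p x + b * Nit p y.
Proof.
move=> a0 b0 vx vy; elim: p x y z vx vy => [|p IH] x y z vx vy hz /=.
  rewrite ge_max; apply/andP; split.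
    apply: supnorm_le => k; apply: le_trans (hz k) _.
    apply: lerD; apply: ler_wpM2l => //; rewrite le_max.
      by rewrite (coord_supnorm k vx).
    by rewrite (coord_supnorm k vy).
  apply: le_trans (normF_dom a0 b0 vx vy hz) _.
  by apply: lerD; apply: ler_wpM2l => //; rewrite le_max lexx orbT.
rewrite !ge_max; apply/and3P; split.
- apply: le_trans (IH _ _ _ vx vy hz) _.
  by apply: lerD; apply: ler_wpM2l => //; rewrite le_max lexx.
- apply: le_trans (normF_dom a0 b0 vx vy hz) _.
  by apply: lerD; apply: ler_wpM2l => //; rewrite !le_max lexx !orbT.
- apply: ge_sup (Tstep_ne _ _) _ => _ [m [Es [m0 [ad ->]]]].
  have leN v : vanishes_from n v -> theta m * \sum_(E <- Es) Nit p (restr E v) <=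
      Num.max (Nit p v) (Num.max (normF F0 v) (Tstep Fs theta (Nit p) v)).
    move=> hv; rewrite !le_max; apply/orP; right; apply/orP; right.
    by apply: (ub_le_sup (Tstep_ub p hv)); exists m, Es.
  apply: (@le_trans _ _ (a * (theta m * \sum_(E <- Es) Nit p (restr E x)) +
                         b * (theta m * \sum_(E <- Es) Nit p (restr E y)))); last first.
    by apply: lerD; apply: ler_wpM2l => //; exact: leN.
  rewrite !mulrA ![_ * theta m]mulrC -!mulrA -mulrDr ler_wpM2l ?theta0 //.
  rewrite !mulr_sumr -big_split /=; apply: ler_sum => E _.
  apply: IH; try exact: vanishes_restr.
  by move=> k; rewrite /restr; case: ifP => // _; rewrite !normr0 !mulr0 addr0.
Qed.

Lemma Nit_le p q x : (p <= q)%N -> Nit p x <= Nit q x.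
Proof.
move=> /subnKC <-; elim: (q - p)%N => [|d IH]; first by rewrite addn0.
by rewrite addnS /= le_max IH.
Qed.

Lemma Nit_Tnorm p n x : vanishes_from n x -> Nit p x <= N x.
Proof.
move=> h; apply: ub_le_sup; last by exists p.
by exists (l1 n x) => _ [q _ <-]; case/andP: (Nit_bound q h).
Qed.

Lemma Tnorm_leP x b : (forall p, Nit p x <= b) -> N x <= b.
Proof. by move=> h; apply: ge_sup => [|_ [p _ <-]//]; exists (Nit 0 x), 0%N. Qed.

Lemma Tnorm_ge0 n x : vanishes_from n x -> 0 <= N x.
Proof. by move=> h; apply: le_trans (Nit_ge0 0 h) (Nit_Tnorm 0 h). Qed.

Lemma Tnorm_l1 n x : vanishes_from n x -> N x <= l1 n x.
Proof. by move=> h; apply: Tnorm_leP => p; case/andP: (Nit_bound p h). Qed.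

Lemma coord_Tnorm n x k : vanishes_from n x -> `|x k| <= N x.
Proof.
move=> h; apply: le_trans (Nit_Tnorm 0 h) => /=.
by rewrite le_max (coord_supnorm k h).
Qed.

Lemma normF_Tnorm n x (s : seq nat) : vanishes_from n x -> uniq s -> F0 [set k | k \in s] ->
  \sum_(k <- s) `|x k| <= N x.
Proof.
move=> h us Fs'; apply: le_trans (normF_seq h us Fs') _.
by apply: le_trans (Nit_Tnorm 0 h) => /=; rewrite le_max lexx orbT.
Qed.

Lemma Tnorm_dom n (a b : R) x y z : 0 <= a -> 0 <= b ->
  vanishes_from n x -> vanishes_from n y ->
  (forall k, `|z k| <= a * `|x k| + b * `|y k|) -> N z <= a * N x + b * N y.
Proof.
move=> a0 b0 vx vy hz; apply: Tnorm_leP => p.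
apply: le_trans (Nit_dom p a0 b0 vx vy hz) _.
by apply: lerD; apply: ler_wpM2l => //; apply: Nit_Tnorm; eassumption.
Qed.

Lemma Tnorm_scale_le n (a : R) x z : 0 <= a -> vanishes_from n x ->
  (forall k, `|z k| <= a * `|x k|) -> N z <= a * N x.
Proof.
move=> a0 vx hz; have := @Tnorm_dom n a 0 x x z a0 (lexx _) vx vx.
by rewrite mul0r addr0; apply => k; rewrite mul0r addr0.
Qed.

Lemma Tnorm_restr n x E : vanishes_from n x -> N (restr E x) <= N x.
Proof.
move=> vx; rewrite -[leRHS]mul1r; apply: Tnorm_scale_le vx _ => // k.
by rewrite mul1r /restr; case: ifP; rewrite ?normr0.
Qed.

Lemma Tnorm_sum n (I : Type) (r : seq I) (w : I -> R) (y : I -> nat -> R) z :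
  (forall i, 0 <= w i) -> (forall i, vanishes_from n (y i)) ->
  (forall k, `|z k| <= \sum_(i <- r) w i * `|y i k|) ->
  N z <= \sum_(i <- r) w i * N (y i).
Proof.
move=> w0 vy; elim: r z => [|i r IH] z hz.
  have v0 : vanishes_from 0 z.
    by move=> k _; apply/eqP; rewrite -normr_le0; have := hz k; rewrite big_nil.
  by apply: le_trans (Tnorm_l1 v0) _; rewrite /l1 !big_nil.
pose z' k := \sum_(j <- r) w j * `|y j k|.
have z'0 k : 0 <= z' k by apply: sumr_ge0 => j _; rewrite mulr_ge0.
have vz' : vanishes_from n z'.
  by move=> k nk; rewrite /z' big1 // => j _; rewrite (vy j k nk) normr0 mulr0.
rewrite big_cons; apply: le_trans (_ : _ <= w i * N (y i) + 1 * N z') _.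
  apply: (Tnorm_dom (n := n)) => // k; rewrite mul1r (ger0_norm (z'0 k)).
  by have := hz k; rewrite big_cons.
rewrite mul1r lerD2l; apply: IH => k; by rewrite (ger0_norm (z'0 k)).
Qed.

(** One half of the implicit equation for the norm; [Tnorm_le] is the other half. With both
    available, the iterates are no longer needed. *)
Lemma Tnorm_step n m x Es : (0 < m)%N -> vanishes_from n x -> admissible (Fs m) Es ->
  theta m * \sum_(E <- Es) N (restr E x) <= N x.
Proof.
move=> m0 vx ad; case/andP: (theta01 m0) => t0 _; rewrite mulrC -ler_pdivlMr //.
apply: sum_sup_le => [E p q|p]; first exact: Nit_le.
rewrite ler_pdivlMr // mulrC; apply: le_trans (Nit_Tnorm p.+1 vx) => /=.
rewrite !le_max; apply/orP; right; apply/orP; right.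
by apply: (ub_le_sup (Tstep_ub p vx)); exists m, Es.
Qed.

Lemma Tnorm_le n x b : vanishes_from n x -> (forall k, `|x k| <= b) ->
  (forall s, sorted ltn s -> F0 [set k | k \in s] -> \sum_(k <- s) `|x k| <= b) ->
  (forall m Es, (0 < m)%N -> admissible (Fs m) Es ->
     theta m * \sum_(E <- Es) N (restr E x) <= b) -> N x <= b.
Proof.
move=> vx h1 h2 h3; apply: Tnorm_leP; elim=> [|p IH] /=.
  by rewrite ge_max supnorm_le ?normF_le.
rewrite !ge_max IH normF_le //=; apply: ge_sup (Tstep_ne _ _) _ => _ [m [Es [m0 [ad ->]]]].
apply: le_trans (h3 _ _ m0 ad); rewrite ler_wpM2l ?theta0 //; apply: ler_sum => E _.
exact: (Nit_Tnorm p (vanishes_restr E vx)).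
Qed.

End NormLemmas.

(** * The upper bound *)

Section Convexity.
Variable R : realType.
Implicit Types (x y z : nat -> R) (s t ys : seq (nat -> R)).
Local Notation "s '`[' i ']'" := (nth (@vzero R) s i) (at level 2, format "s `[ i ]").

Definition blocks ys := forall i j, (i < j < size ys)%N -> forall a b,
  ys`[i] a != 0 -> ys`[j] b != 0 -> (a < b)%N.

Definition lincomb (w : nat -> R) ys : nat -> R :=
  fun k => \sum_(0 <= i < size ys) w i * ys`[i] k.

Definition conv s x := exists w : nat -> R,
  [/\ forall i, 0 <= w i, \sum_(0 <= i < size s) w i = 1 & x = lincomb w s].

Lemma conv_nth s i : (i < size s)%N -> conv s s`[i].
Proof.
move=> h; exists (fun j => (j == i)%:R); split=> [j||].
- exact: ler0n.
- rewrite big_mkord (bigD1 (Ordinal h)) //= eqxx big1 ?addr0 // => j ji.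
  by case: eqP => // e; case/eqP: ji; exact: val_inj.
- apply/funext => k; rewrite /lincomb big_mkord (bigD1 (Ordinal h)) //= eqxx mul1r big1 ?addr0 // => j ji.
  by case: eqP => [e|]; rewrite ?mul0r //; case/eqP: ji; exact: val_inj.
Qed.

Lemma conv_trans s t x : (forall i, (i < size s)%N -> conv t s`[i]) -> conv s x -> conv t x.
Proof.
move=> h [w [w0 w1 ->]].
have /choice[W hW] : forall i, exists W : nat -> R, (i < size s)%N ->
    [/\ forall j, 0 <= W j, \sum_(0 <= j < size t) W j = 1 & s`[i] = lincomb W t].
  move=> i; case: (ltnP i (size s)) => [/h[W hW]|_]; by [exists W|exists (fun=> 0)].
exists (fun j => \sum_(0 <= i < size s) w i * W i j); split.
- move=> j; rewrite big_nat; apply: sumr_ge0 => i /andP[_ /hW[h1 _ _]].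
  by rewrite mulr_ge0.
- rewrite exchange_big /= -w1 [LHS]big_nat [RHS]big_nat; apply: eq_bigr => i /andP[_ /hW[_ e _]].
  by rewrite -mulr_sumr e mulr1.
- apply/funext => k; rewrite /lincomb.
  under [RHS]eq_bigr do rewrite mulr_suml.
  rewrite exchange_big /= [LHS]big_nat [RHS]big_nat.
  apply: eq_bigr => i /andP[_ /hW[_ _ ->]].
  by rewrite /lincomb mulr_sumr; apply: eq_bigr => j _; rewrite mulrA.
Qed.

Lemma conv_catl s u x : conv s x -> conv (s ++ u) x.
Proof.
apply: conv_trans => i h; have := @conv_nth (s ++ u) i.
by rewrite size_cat nth_cat h; apply; rewrite ltn_addr.
Qed.

Lemma conv_supp s x a : conv s x -> x a != 0 -> exists2 i, (i < size s)%N & s`[i] a != 0.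
Proof.
move=> [w [_ _ ->]] h; apply: contrapT => no; case/eqP: h; rewrite /lincomb big_nat big1 //.
move=> i /andP[_ hi]; have [->|ne] := eqVneq (s`[i] a) 0; first by rewrite mulr0.
by case: no; exists i.
Qed.

Lemma lincomb_conv w m s : mass_on w m (size s) 1 -> conv s (lincomb w s).
Proof. by move=> [w0 _ w1]; exists w. Qed.

Lemma lincomb_supp w m n s a : mass_on w m n 1 -> lincomb w s a != 0 ->
  exists2 i, (m <= i < size s)%N & s`[i] a != 0.
Proof.
move=> [_ ws _] h; apply: contrapT => no; case/eqP: h; rewrite /lincomb big_nat big1 //.
move=> i /andP[_ hi]; have [->|ne] := eqVneq (s`[i] a) 0; first by rewrite mulr0.
case: (leqP m i) => mi; first by case: no; exists i; rewrite ?mi.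
by rewrite ws ?mul0r // negb_and -ltnNge mi.
Qed.

Variable T0 : set (seq (nat -> R)).

(* The trees of iterated averages: good block sequences inside the convex hull
   of a single node of [T0]. *)
Definition hull_tree (G : (nat -> R) -> Prop) : set (seq (nat -> R)) :=
  [set xs | [/\ blocks xs,
    exists2 t, T0 t & forall i, (i < size xs)%N -> conv t xs`[i] &
    forall i, (i < size xs)%N -> G xs`[i]]].

Lemma hull_take G s n : hull_tree G s -> (0 < n)%N -> hull_tree G (take n s).
Proof.
move=> [h1 [t Tt h2] h3] _; have sz i : (i < size (take n s) -> i < n /\ i < size s)%N.
  by rewrite size_take_min leq_min => /andP[].
split.
- move=> i j /andP[ij jn] a b; have [jn' js] := sz _ jn.
  by rewrite !nth_take ?(ltn_trans ij) //; apply: h1; rewrite ij.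
- by exists t => // i /sz[? ?]; rewrite nth_take //; exact: h2.
- by move=> i /sz[? ?]; rewrite nth_take //; exact: h3.
Qed.

(** Each step of [c] pays for one averaged vector: [N] copies of omega^g in the old tree yield
    weights that are small on the covers of all [a j]. The weights sit on new positions only, so the
    averages are again successive blocks. *)
Lemma stage (G G' : (nat -> R) -> Prop) be (e : R) g (a : nat -> ord) n :
  prefix_mono be -> 0 < e -> (forall j, (j < n)%N -> ole (a j) (oexp omega g)) ->
  (forall t w m, hull_tree G t -> mass_on w m (size t) 1 ->
    (forall j B, (j < n)%N -> sorted ltn B -> cov (a j) (map (budget be t) B) ->
       \sum_(i <- B) w i <= e) -> G' (lincomb w t)) ->
  exists N, forall c s, tderiv (hull_tree G) (omul (omul (oexp omega g) (ofin N)) c) s ->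
    tderiv (hull_tree G') c [::].
Proof.
move=> bm e0 ale an.
have /choice[p hp] : forall j, exists q, {homo q : v w / (v <= w)%N} /\
    ((j < n)%N -> dominates q (a j) (oexp omega g)).
  move=> j; case: (ltnP j n) => [jn|_]; last by exists (fun v => v); split.
  by have [q ? ?] := ole_dominates (ale j jn); exists q.
(* One enlargement of budgets for the finitely many [a j], which turns all their covers into covers
   of omega^g. *)
pose psi w := (\max_(j < n) p j w)%N.
have [|N hN] := @average_lemma_holds R (hull_tree G) (@hull_take G) g (psi \o be) e _ e0.
  move=> s u; apply/bigmax_leqP => i _; apply: leq_trans (leq_bigmax i).
  by apply: (hp i).1; exact: bm.
exists N; set Z := omul _ (ofin N) => c s hs.
have : hull_tree G' [::] /\ forall i, (i < size ([::] : seq (nat -> R)))%N -> conv s [::]`[i].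
  split=> //; have [_ [t Tt _] _] := tderiv_sub hs.
  by split=> //; [move=> i j /andP[]|exists t].
(* Generalised to averages [xs] already formed from [s], so that node and averages grow together. *)
move: [::] => xs; elim: c s xs hs => [|c IH|f IH] s xs hs [Txs cxs].
- exact: Txs.
- split.
    apply: (IH s) => //; apply: (@tderiv_le _ (hull_tree G)) hs; exact: oadd_ler.
  have [u [w [h1 mw h2]]] := hN _ _ hs.
  set z := lincomb w (s ++ u).
  exists (rcons xs z); rewrite size_rcons ltnSn; split; last first.
    by split=> //; rewrite -cats1 take_size_cat.
  have Tsu := tderiv_sub h1.
  have cz : conv (s ++ u) z by exact: lincomb_conv mw.
  have nthr i : (i < (size xs).+1)%N ->
      ((i < size xs)%N /\ (rcons xs z)`[i] = xs`[i]) \/ (i = size xs /\ (rcons xs z)`[i] = z).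
    rewrite nth_rcons ltnS leq_eqVlt => /orP[/eqP->|->]; last by left.
    by rewrite ltnn eqxx; right.
  have call i : (i < size (rcons xs z))%N -> conv (s ++ u) (rcons xs z)`[i].
    rewrite size_rcons => /nthr[[h ->]|[_ ->]//].
    by apply: conv_catl; exact: cxs.
  apply: IH h1 _; split=> //; split.
  + move=> i j /andP[ij]; rewrite size_rcons => js a' b'.
    have [[_ ->]|[ei _]] := nthr i (ltn_trans ij js); last first.
      by move: js; rewrite ltnS leqNgt -ei ij.
    have [[js' ->]|[ej ->]] := nthr j js.
      by case: Txs => h _ _; apply: h; rewrite ij.
    have is' : (i < size xs)%N by rewrite -ej.
    move=> /(conv_supp (cxs i is'))[k ks hk] /(lincomb_supp mw)[l /andP[l1 l2] hl].
    case: Tsu => hb _ _; apply: (hb k l) => //.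
      by rewrite (leq_trans ks l1).
    by rewrite nth_cat ks.
  + case: Tsu => _ [t Tt ht] _; exists t => // i /call; exact: conv_trans.
  + move=> i; rewrite size_rcons => /nthr[[h ->]|[_ ->]].
      by case: Txs => _ _; apply.
    apply: an Tsu mw _ => j B jn sB /((hp j).2 jn _ (sorted_budget _ bm sB)) h3.
    apply: h2 => //; move: h3; rewrite -map_comp; apply: cov_le.
    apply: all2_map_leq => i' _ /=.
    exact: (leq_bigmax (F := fun j : 'I_n => p j _) (Ordinal jn)).
- by move=> k; exact: (IH k s).
Qed.

End Convexity.

(** Bernoulli's inequality in the form [t ^+ k * (1 + k * (1 - t)) <= 1]. *)
Lemma expr_small (R : realType) (t d : R) : 0 < t < 1 -> 0 < d -> exists k, t ^+ k < d.
Proof.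
move=> /andP[t0 t1] d0.
have bern k : t ^+ k * (1 + k%:R * (1 - t)) <= 1.
  elim: k => [|k IH]; first by rewrite expr0 mul0r addr0 mul1r.
  rewrite exprS -natr1; apply: le_trans IH.
  rewrite [t * _]mulrC -mulrA ler_pM2l ?exprn_gt0 //.
  have : 0 <= (k%:R + 1) * (1 - t) ^+ 2 by rewrite mulr_ge0 ?sqr_ge0 ?addr_ge0.
  by move: (k%:R) => u; nra.
have [k hk] : exists k, (d * (1 - t))^-1 < k.+1%:R.
  by exists (Num.truncn (d * (1 - t))^-1); apply: truncnS_gt.
exists k.+1; have p0 : 0 < d * (1 - t) by rewrite mulr_gt0 // subr_gt0.
have : 1 < k.+1%:R * (d * (1 - t)) by rewrite -ltr_pdivrMr // div1r.
have := bern k.+1; set q := t ^+ _; set u := k.+1%:R => h1 h2.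
have q0 : 0 < q by rewrite exprn_gt0.
rewrite ltNge; apply/negP => dq; nra.
Qed.

(** The exceptional indices [Q] carry mass at most [e], and there the trivial bound 1 is enough. *)
Lemma sum_weights_split (R : realType) n (w f : nat -> R) (Q : nat -> Prop) (c e : R) :
  (forall i, 0 <= w i) -> \sum_(0 <= i < n) w i = 1 -> 0 <= c ->
  (forall i, (i < n)%N -> f i <= 1) -> (forall i, (i < n)%N -> ~ Q i -> f i <= c) ->
  \sum_(i <- [seq i <- iota 0 n | `[< Q i >]]) w i <= e ->
  \sum_(0 <= i < n) w i * f i <= e + c.
Proof.
move=> w0 w1 c0 f1 fc he.
apply: (@le_trans _ _ (\sum_(0 <= i < n) ((if `[< Q i >] then w i else 0) + w i * c))).
  rewrite [leLHS]big_nat [leRHS]big_nat; apply: ler_sum => i /andP[_ hi].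
  case: asboolP => [_|/(fc _ hi) h]; last by rewrite add0r ler_wpM2l.
  have := w0 i; have := f1 i hi; move: (w i) (f i) => a b h1 h2; nra.
rewrite big_split /= -mulr_suml w1 mul1r lerD2r -big_mkcond /=.
by move: he; rewrite big_filter /index_iota subn0.
Qed.

Lemma leq_term_sum (f : nat -> nat) m n : (m < n)%N -> (f m <= \sum_(0 <= i < n) f i)%N.
Proof. by move=> h; rewrite (big_rem m) ?mem_index_iota //= leq_addr. Qed.

(** * The effect of averaging on the norm *)

Section UpperBound.
Variables (R : realType) (alpha : nat -> ord) (H : nat -> nat -> nat) (theta : nat -> R).
Hypothesis H_mono : forall n, {homo H n : v w / (v <= w)%N}.
Hypothesis theta01 : forall m, (0 < m)%N -> 0 < theta m < 1.
Hypothesis theta_dec : forall n, (0 < n)%N -> theta n.+1 <= theta n.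
Hypothesis theta_null : forall e : R, 0 < e -> exists M, forall n, (M <= n)%N -> theta n < e.
Local Notation "s '`[' i ']'" := (nth (@vzero R) s i) (at level 2, format "s `[ i ]").
Implicit Types (x y z : nat -> R) (s t ys : seq (nat -> R)).

Let F n := Fam (H n) (alpha n).
Let N := Tnorm (F 0) F theta.

Lemma F_fin m A : F m A -> finite_set A.
Proof. by have [_ [_ [h _]]] := Fam_regular (@H_mono m) (alpha m); apply: h. Qed.

Lemma F_0 m : F m set0.
Proof. by exists [::]; split=> //; apply/seteqP; split. Qed.

Let F_0' m : (0 < m)%N -> F m set0. Proof. by move=> _; exact: F_0. Qed.

Lemma theta_le1 m : (0 < m)%N -> theta m <= theta 1.
Proof. by case: m => [//|m] _; elim: m => [//|m]; apply: le_trans; exact: theta_dec. Qed.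

Definition finitely_supported y := exists n, vanishes_from n y.

(** Some bound of the support, not the least one; the default 0 concerns only vectors that are not
    finitely supported. *)
Definition top y : nat := xget 0%N [set n | vanishes_from n y].

Lemma topP y : finitely_supported y -> vanishes_from (top y) y.
Proof. by move=> [n h]; apply: (xgetPex 0%N (P := [set n | vanishes_from n y])); exists n. Qed.

Lemma supp_top y a : finitely_supported y -> y a != 0 -> (a < top y)%N.
Proof. by move=> /topP h; apply: contraNT; rewrite -leqNgt => /h ->. Qed.

Definition mins (Es : seq (set nat)) : set nat :=
  [set m | exists i, (i < size Es)%N /\ is_min m (nth set0 Es i)].

(** If two members of an admissible sequence meet the support of [y], the minimum of the later one
    lies between two support points. Vectors not straddled by the minima are therefore met by at
    most one member. *)
Definition straddled (A : set nat) y := exists e a b,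
  [/\ A e, y a != 0, y b != 0 & (a <= e <= b)%N].

(** Points of [A] that straddle successive blocks increase, so by heredity they form a member of
    [F m]. Replacing each of them by the [top] of its block only raises the budgets. *)
Lemma mark_cov m (A : set nat) ys B : F m A -> blocks ys -> sorted ltn B ->
  (forall i, i \in B -> [/\ (i < size ys)%N, finitely_supported ys`[i] & straddled A ys`[i]]) ->
  cov (alpha m) (map (fun i => H m (top ys`[i])) B).
Proof.
move=> FA bl sB h.
have /choice[e he] : forall i, exists e, i \in B -> A e /\ exists a b,
    [/\ ys`[i] a != 0, ys`[i] b != 0 & (a <= e <= b)%N].
  move=> i; case: (boolP (i \in B)) => [/h[_ _ [e [a [b [? ? ? ?]]]]]|_]; last by exists 0%N.
  by exists e => _; split=> //; exists a, b.
have se : sorted ltn (map e B).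
  rewrite sorted_map; apply: (sub_in_sorted (P := mem B)) sB; last exact/allP.
  move=> i j iB jB ij /=; have [_ [a [b [_ yb /andP[_ eb]]]]] := he i iB.
  have [_ [a' [b' [ya' _ /andP[ae _]]]]] := he j jB.
  apply: leq_ltn_trans eb (leq_trans _ ae); apply: (bl i j) => //.
  by apply/andP; split=> //; case: (h j jB).
have : F m [set k | k \in map e B].
  apply: (Fam_hereditary (@H_mono m)) FA _ => k /mapP[i /he[h' _] ->].
  exact: h'.
move=> /(Fam_seq _ _ se); rewrite -map_comp; apply: cov_le.
apply: all2_map_leq => i iB /=; apply: H_mono.
have [_ [a [b [_ yb /andP[_ eb]]]]] := he i iB.
by apply: leq_trans eb (ltnW (supp_top _ yb)); case: (h i iB).
Qed.

Lemma Tnorm_restr0 y E : (forall k, E k -> y k = 0) -> N (restr E y) <= 0.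
Proof.
move=> h; have v : vanishes_from 0 (restr E y).
  by move=> k _; rewrite /restr; case: ifP => // /set_mem/h.
by apply: le_trans (Tnorm_l1 (@F_fin 0) (F_0 0) F_0' theta01 v) _; rewrite /l1 big_nil.
Qed.

Lemma N_ge0 y : finitely_supported y -> 0 <= N y.
Proof. by move=> /topP/(Tnorm_ge0 (@F_fin 0) (F_0 0) F_0' theta01). Qed.

Lemma sum_not_straddled m Es y : admissible (F m) Es -> finitely_supported y ->
  ~ straddled (mins Es) y -> \sum_(E <- Es) N (restr E y) <= N y.
Proof.
move=> [ne [su _]] fy ns.
pose meets i := exists2 a, nth set0 Es i a & y a != 0.
have nomeet i : ~ meets i -> N (restr (nth set0 Es i) y) <= 0.
  move=> h; apply: Tnorm_restr0 => k Ek; apply/eqP; apply: contrapT => /negP yk.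
  by apply: h; exists k.
rewrite (big_nth set0) big_mkord.
have [[i hi]|no] := pselect (exists i : 'I_(size Es), meets i); last first.
  apply: le_trans (N_ge0 fy); apply: sumr_le0 => i _; apply: nomeet => h.
  by apply: no; exists i.
rewrite (bigD1 i) //= -[leRHS]addr0; apply: lerD.
  exact: (Tnorm_restr (@F_fin 0) (F_0 0) F_0' theta01 _ (topP fy)).
apply: sumr_le0 => j ji; apply: nomeet => hj.
have bad (k l : 'I_(size Es)) : (k < l)%N -> meets k -> meets l -> False.
  move=> kl [a Ea ya] [b Eb yb]; apply: ns.
  have ex : exists e, `[< nth set0 Es l e >] by exists b; apply/asboolP.
  have := ex_minnP ex; case=> e /asboolP Ee emin.
  have emin' c : nth set0 Es l c -> (e <= c)%N by move=> h; apply: emin; apply/asboolP.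
  exists e, a, b; split=> //; first by exists l; split=> //; split.
  rewrite emin' // andbT ltnW //; apply: (su k l) => //; by rewrite kl ltn_ord.
have [ij|ij|/val_inj e] := ltngtP i j; last by rewrite e eqxx in ji.
  exact: bad ij hi hj.
exact: bad ij hj hi.
Qed.

Definition sigma m Es y := theta m * \sum_(E <- Es) N (restr E y).

Lemma sigma_le_norm m Es y : (0 < m)%N -> admissible (F m) Es -> finitely_supported y ->
  sigma m Es y <= N y.
Proof. by move=> m0 ad /topP v; exact: (Tnorm_step (@F_fin 0) (F_0 0) F_0' theta01 m0 v ad). Qed.

Lemma sigma_not_straddled m Es y : (0 < m)%N -> admissible (F m) Es -> finitely_supported y ->
  ~ straddled (mins Es) y -> sigma m Es y <= theta m * N y.
Proof.
move=> m0 ad fy ns; rewrite /sigma ler_wpM2l //; last exact: sum_not_straddled ad fy ns.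
by case/andP: (theta01 m0) => /ltW.
Qed.

Lemma sigma_l1 m Es y : (0 < m)%N -> admissible (F m) Es -> finitely_supported y ->
  sigma m Es y <= theta m * l1 (top y) y.
Proof.
move=> m0 [_ [su _]] /topP v; rewrite /sigma ler_wpM2l //; first by case/andP: (theta01 m0) => /ltW.
apply: le_trans (sum_l1_restr (top y) y su); apply: ler_sum => E _.
exact: (Tnorm_l1 (@F_fin 0) (F_0 0) F_0' theta01 (vanishes_restr E v)).
Qed.

Lemma common_support ys : (forall i, (i < size ys)%N -> finitely_supported ys`[i]) ->
  exists n, forall i, vanishes_from n ys`[i].
Proof.
move=> h; exists (\max_(i < size ys) top ys`[i])%N => i k hk.
case: (ltnP i (size ys)) => [hi|hi]; last by rewrite nth_default.
apply: (topP (h i hi)); apply: leq_trans hk.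
exact: (leq_bigmax (F := fun i : 'I_(size ys) => top ys`[i]) (Ordinal hi)).
Qed.

Lemma lincomb_abs w ys k : (forall i, 0 <= w i) ->
  `|lincomb w ys k| <= \sum_(0 <= i < size ys) w i * `|ys`[i] k|.
Proof.
move=> w0; apply: le_trans (ler_norm_sum _ _ _) _; apply: ler_sum => i _.
by rewrite normrM ger0_norm.
Qed.

Lemma lincomb_fs w ys : (forall i, (i < size ys)%N -> finitely_supported ys`[i]) ->
  finitely_supported (lincomb w ys).
Proof.
move=> /common_support[n h]; exists n => k nk.
by rewrite /lincomb big1 // => i _; rewrite h // mulr0.
Qed.

Lemma sigma_lincomb m Es w ys : (0 < m)%N -> (forall i, 0 <= w i) ->
  (forall i, (i < size ys)%N -> finitely_supported ys`[i]) ->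
  sigma m Es (lincomb w ys) <= \sum_(0 <= i < size ys) w i * sigma m Es ys`[i].
Proof.
move=> m0 w0 /common_support[n h].
have -> : \sum_(0 <= i < size ys) w i * sigma m Es ys`[i] =
    theta m * \sum_(E <- Es) \sum_(0 <= i < size ys) w i * N (restr E ys`[i]).
  rewrite exchange_big /= mulr_sumr; apply: eq_bigr => i _.
  by rewrite /sigma -mulr_sumr; lra.
rewrite /sigma ler_wpM2l //; first by case/andP: (theta01 m0) => /ltW.
apply: ler_sum => E _.
apply: (Tnorm_sum (@F_fin 0) (F_0 0) F_0' theta01 (n := n) (y := fun i => restr E ys`[i])) => //.
  by move=> i; exact: vanishes_restr.
move=> k; rewrite /restr; case: ifP => _; first exact: lincomb_abs.
by rewrite normr0 sumr_ge0 // => i _; rewrite mulr0.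
Qed.

Definition maxbe (mu : (nat -> R) -> nat) s : nat := \max_(y <- s) mu y.

Lemma maxbe_mono mu : prefix_mono (maxbe mu).
Proof. by move=> s u; rewrite /maxbe big_cat leq_maxl. Qed.

Lemma maxbe_ge mu s i : (i < size s)%N -> (mu s`[i] <= budget (maxbe mu) s i)%N.
Proof.
move=> h; rewrite /budget /maxbe (take_nth (@vzero R)) // -cats1 big_cat big_seq1.
exact: leq_maxr.
Qed.

Definition good0 y := finitely_supported y /\ N y <= 1.

(** The last clause is inherited by convex combinations. Once it holds, only the families before
    [n0] have to be treated in later stages. *)
Definition good (n0 : nat) (e r : R) x := [/\ finitely_supported x, N x <= r &
  forall m Es, (n0 <= m)%N -> (0 < m)%N -> admissible (F m) Es -> sigma m Es x <= 3 * e].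

Lemma straddled_filter_weight m (A : set nat) ys w (P : nat -> Prop) be a (e : R) : F m A -> blocks ys ->
  (forall i, (i < size ys)%N -> finitely_supported ys`[i]) ->
  (forall i, (i < size ys)%N -> P i -> straddled A ys`[i]) ->
  (forall B, sorted ltn B -> (forall i, i \in B -> (i < size ys)%N /\ P i) ->
    cov (alpha m) (map (fun i => H m (top ys`[i])) B) -> cov a (map (budget be ys) B)) ->
  (forall B, sorted ltn B -> cov a (map (budget be ys) B) -> \sum_(i <- B) w i <= e) ->
  \sum_(i <- [seq i <- iota 0 (size ys) | `[< P i >]]) w i <= e.
Proof.
move=> FA bl fs st tr kill.
have mem i : i \in [seq i <- iota 0 (size ys) | `[< P i >]] -> (i < size ys)%N /\ P i.
  by rewrite mem_filter mem_iota => /andP[/asboolP h /andP[_ h']].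
have sB : sorted ltn [seq i <- iota 0 (size ys) | `[< P i >]].
  by apply: (sorted_filter ltn_trans); exact: iota_ltn_sorted.
apply: kill => //; apply: tr => //; apply: mark_cov FA bl sB _ => i /mem[h1 h2].
by split=> //; [exact: fs|exact: st].
Qed.

Lemma mean_norm_le w ys r : (forall i, 0 <= w i) -> \sum_(0 <= i < size ys) w i = 1 ->
  (forall i, (i < size ys)%N -> finitely_supported ys`[i] /\ N ys`[i] <= r) ->
  N (lincomb w ys) <= r.
Proof.
move=> w0 w1 h; have [n hn] := common_support (fun i hi => (h i hi).1).
apply: le_trans (Tnorm_sum (@F_fin 0) (F_0 0) F_0' theta01 (n := n) w0 hn
  (fun k => lincomb_abs ys k w0)) _.
rewrite -[leRHS]mul1r -[X in _ <= X * _]w1 mulr_suml [leLHS]big_nat [leRHS]big_nat; apply: ler_sum => i /andP[_ hi].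
by rewrite ler_wpM2l //; case: (h i hi).
Qed.

(* For [n0 <= m], a vector [y] is only seen by [theta m] if [m] is bounded in terms of the
   l1-norm of [y]; so the relevant covers are [OL alpha]-covers, and averaging over a tree
   of order [Om] makes all [m >= n0] negligible at once. *)
Lemma first_stage n0 (e : R) T0 : 0 < e -> (forall m, (n0 <= m)%N -> theta m <= e) ->
  exists be, prefix_mono be /\
  (forall t w m, hull_tree T0 good0 t -> mass_on w m (size t) 1 ->
    (forall B, sorted ltn B -> cov (OL alpha) (map (budget be t) B) ->
       \sum_(i <- B) w i <= e) -> good n0 e 1 (lincomb w t)).
Proof.
move=> e0 hn0.
have /choice[Mf hMf] : forall y, exists M, forall m, (M <= m)%N -> theta m * l1 (top y) y <= e.
  move=> y; have l0 : 0 < l1 (top y) y + 1 by have := l1_ge0 (top y) y; lra.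
  have [M hM] := theta_null (divr_gt0 e0 l0); exists (maxn M 1) => m.
  rewrite geq_max => /andP[/hM]; rewrite ltr_pdivlMr // => /ltW h m0.
  apply: le_trans h; rewrite ler_wpM2l //; last by lra.
  by case/andP: (theta01 m0) => /ltW.
(* For each [m < Mf y] this is at least [m], so that a countdown from [OL alpha] may choose
   [alpha m], and at least the budget that [F m] assigns to the end of [y]. *)
pose mu y : nat := (\sum_(0 <= m < Mf y) (m + H m (top y)))%N.
exists (maxbe mu); split; first exact: maxbe_mono.
move=> t w p [bl _ gd] [w0 _ w1] kill.
have fs i : (i < size t)%N -> finitely_supported t`[i] by move=> /gd[].
split; first exact: lincomb_fs.
  by apply: mean_norm_le => // i /gd.
move=> m Es n0m m0 ad.
apply: le_trans (sigma_lincomb Es m0 w0 fs) _.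
pose P i := straddled (mins Es) t`[i] /\ e < theta m * l1 (top t`[i]) t`[i].
apply: le_trans (sum_weights_split (Q := P) (c := e) (e := e) w0 w1 _ _ _ _) _.
- exact: ltW.
- by move=> i hi; apply: le_trans (sigma_le_norm m0 ad (fs _ hi)) _; case: (gd _ hi).
- move=> i hi nP; have [st|nst] := pselect (straddled (mins Es) t`[i]).
    apply: le_trans (sigma_l1 m0 ad (fs _ hi)) _; rewrite leNgt; apply/negP => h.
    by apply: nP.
  apply: le_trans (sigma_not_straddled m0 ad (fs _ hi) nst) _.
  have := hn0 _ n0m; case/andP: (theta01 m0) => t0 _ te; have [_ N1] := gd _ hi.
  have := N_ge0 (fs _ hi); nra.
- apply: (@straddled_filter_weight m (mins Es) t w P (maxbe mu) (OL alpha)) => //.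
    by case: ad => _ [].
    by move=> i _ [].
  move=> [//|i B] sB hB cB; have mM j : j \in i :: B -> (m < Mf t`[j])%N.
    move=> /hB[_ [_ h]]; rewrite ltnNge; apply/negP => /hMf h'.
    by move: h; rewrite ltNge h'.
  have le j : j \in i :: B -> (m + H m (top t`[j]) <= budget (maxbe mu) t j)%N.
    move=> jB; apply: leq_trans (maxbe_ge mu (hB j jB).1).
    exact: (@leq_term_sum (fun m => m + H m (top t`[j]))%N) (mM _ jB).
  apply/cov_OLE; exists m; first by apply: leq_trans (le i (mem_head _ _)); rewrite leq_addr.
  apply: cov_le cB; apply: (@all2_map_leq _ _ (budget (maxbe mu) t) (i :: B)) => j jB.
  by apply: leq_trans (le j jB); rewrite leq_addl.
- lra.
Qed.

(** Vectors not straddled by a family before [n0] gain a factor at most [theta 1]; the straddled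
    ones have mass at most [e]. The additional index [n0], with ordinal 1, bounds each single weight
    by [e], which settles the supremum norm because a coordinate lives in only one block. *)
Lemma next_stage n0 (e r : R) T0 : 0 < e -> 0 <= r <= 1 -> (0 < n0)%N ->
  exists be, prefix_mono be /\
  (forall t w m, hull_tree T0 (good n0 e r) t -> mass_on w m (size t) 1 ->
    (forall j B, (j < n0.+1)%N -> sorted ltn B ->
       cov (if (j < n0)%N then alpha j else OS OZ) (map (budget be t) B) ->
       \sum_(i <- B) w i <= e) -> good n0 e (theta 1 * r + 3 * e) (lincomb w t)).
Proof.
move=> e0 /andP[r0 r1] n00.
pose mu y : nat := (\sum_(0 <= m < n0) H m (top y))%N.
exists (maxbe mu); split; first exact: maxbe_mono.
move=> t w p [bl _ gd] [w0 _ w1] kill.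
have fs i : (i < size t)%N -> finitely_supported t`[i] by move=> /gd[].
have star m Es : (n0 <= m)%N -> (0 < m)%N -> admissible (F m) Es ->
    sigma m Es (lincomb w t) <= 3 * e.
  move=> n0m m0 ad; apply: le_trans (sigma_lincomb Es m0 w0 fs) _.
  rewrite -[leRHS]mul1r -[X in _ <= X * _]w1 mulr_suml [leLHS]big_nat [leRHS]big_nat; apply: ler_sum => i /andP[_ hi].
  by rewrite ler_wpM2l //; case: (gd i hi) => _ _; apply.
have tr m P B : (m < n0)%N -> sorted ltn B -> (forall i, i \in B -> (i < size t)%N /\ P i) ->
    cov (alpha m) (map (fun i => H m (top t`[i])) B) ->
    cov (if (m < n0)%N then alpha m else OS OZ) (map (budget (maxbe mu) t) B).
  move=> mn sB hB; rewrite mn; apply: cov_le; apply: all2_map_leq => i iB.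
  apply: leq_trans (maxbe_ge mu (hB i iB).1).
  exact: (@leq_term_sum (fun m => H m (top t`[i]))).
have t1 : 0 < theta 1 < 1 by exact: theta01.
have [zn vz] := lincomb_fs w fs.
have tr0 : 0 <= theta 1 * r by case/andP: t1 => /ltW h _; rewrite mulr_ge0.
split=> //; first by exists zn.
apply: (Tnorm_le (@F_fin 0) (F_0 0) F_0' theta01 vz).
- move=> k; apply: le_trans (lincomb_abs t k w0) _.
  apply: le_trans (sum_weights_split (Q := fun i => t`[i] k != 0) (c := 0) (e := e) w0 w1 _ _ _ _) _ => //.
  + move=> i hi; apply: le_trans (coord_Tnorm (@F_fin 0) (F_0 0) F_0' theta01 k (topP (fs _ hi))) _.
    by case: (gd i hi) => _ h _; apply: le_trans h r1.
  + by move=> i hi /negP; rewrite negbK => /eqP->; rewrite normr0.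
  + apply: (kill n0) => //; first by apply: (sorted_filter ltn_trans); exact: iota_ltn_sorted.
    rewrite ltnn; set B := [seq i <- _ | _].
    have : sorted ltn B by apply: (sorted_filter ltn_trans); exact: iota_ltn_sorted.
    have : forall i, i \in B -> (i < size t)%N /\ t`[i] k != 0.
      by move=> i; rewrite mem_filter mem_iota => /andP[/asboolP h /andP[_ h']].
    case: B => [//|i [|j B]] h /=; first by move=> _; exists OZ.
    move=> /andP[ij _]; have [|is' ik] := h i; first by rewrite mem_head.
    have [|js jk] := h j; first by rewrite !inE eqxx orbT.
    by have := bl i j; rewrite ij js => /(_ isT k k ik jk); rewrite ltnn.
  + lra.
- move=> q sq Fq; apply: le_trans (ler_sum _ (fun k _ => lincomb_abs t k w0)) _.
  rewrite exchange_big /=; under eq_bigr do rewrite -mulr_sumr.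
  pose P i := straddled [set k | k \in q] t`[i].
  apply: le_trans (sum_weights_split (Q := P) (c := 0) (e := e) w0 w1 _ _ _ _) _ => //.
  + move=> i hi; apply: le_trans (normF_Tnorm (@F_fin 0) (F_0 0) F_0' theta01 (topP (fs _ hi)) _ Fq) _.
      exact: sorted_uniq ltn_trans ltnn _ sq.
    by case: (gd i hi) => _ h _; apply: le_trans h r1.
  (* A point of [q] in the support straddles by itself, so an unstraddled vector contributes nothing
     to the [F 0] norm. *)
  + move=> i hi nP; rewrite big_seq big1 // => k kq; apply/eqP; rewrite normr_eq0.
    by apply: contrapT => /negP tk; apply: nP; exists k, k, k; rewrite leqnn.
  + apply: (@straddled_filter_weight 0 [set k | k \in q] t w P (maxbe mu)
      (if (0 < n0)%N then alpha 0%N else OS OZ)) => //.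
      by move=> B; exact: (@tr 0%N P).
    by move=> B; exact: (kill 0%N).
  + lra.
- move=> m Es m0 ad; case: (leqP n0 m) => mn.
    by apply: le_trans (star m Es mn m0 ad) _; lra.
  apply: le_trans (sigma_lincomb Es m0 w0 fs) _.
  pose P i := straddled (mins Es) t`[i].
  apply: le_trans (sum_weights_split (Q := P) (c := theta 1 * r) (e := e) w0 w1 _ _ _ _) _ => //.
  + move=> i hi; apply: le_trans (sigma_le_norm m0 ad (fs _ hi)) _.
    by case: (gd i hi) => _ h _; apply: le_trans h r1.
  + move=> i hi nP; apply: le_trans (sigma_not_straddled m0 ad (fs _ hi) nP) _.
    have [_ Nr _] := gd i hi; have := N_ge0 (fs _ hi); have := theta_le1 m0.
    case/andP: t1 => ? ?; nra.
  + apply: (@straddled_filter_weight m (mins Es) t w P (maxbe mu)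
      (if (m < n0)%N then alpha m else OS OZ)) => //.
    * by case: ad => _ [].
    * by move=> B; exact: (@tr m P).
    * by move=> B; apply: (kill m); exact: ltnW.
  + lra.
Qed.

(** * Iteration of the averages and the contradiction *)

Variable xi : ord.
Hypothesis xi_gt0 : olt OZ xi.
Let Om := oexp omega (oexp omega xi).
Hypothesis alpha_lt : forall n, olt (alpha n) Om.

Lemma ofin_lt_Om n : olt (ofin n) Om.
Proof.
apply: ole_lt_trans (omega_lt_oexpW xi_gt0); exact: (@ole_limr _ _ n).
Qed.

(* [1 - theta 1 ^+ k] sums the errors [3 * e = (1 - theta 1) * c] geometrically. *)
Lemma iterate_stages n0 (e c : R) T0 : 0 < e -> (0 < n0)%N -> 0 <= c <= 1 ->
  3 * e = (1 - theta 1) * c ->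
  forall k r, 0 <= r <= 1 -> exists2 o, olt o Om &
    forall s, tderiv (hull_tree T0 (good n0 e r)) o s ->
    exists2 xs, hull_tree T0 (good n0 e (theta 1 ^+ k * r + (1 - theta 1 ^+ k) * c)) xs &
      (0 < size xs)%N.
Proof.
move=> e0 n00 /andP[c0 c1] ec; have [t0 t1] := andP (theta01 (ltn0Sn 0)).
have /choice[ga hga] : forall m, exists ga, olt ga (oexp omega xi) /\ ole (alpha m) (oexp omega ga).
  by move=> m; have [ga ? ?] := olt_oexpW xi_gt0 (alpha_lt m); exists ga.
(* One exponent below omega^xi for all the families before [n0]; each stage then costs an order
   below [Om]. *)
have [m _ hm] := ole_max_below ga n0.
elim=> [|k IH] r /andP[r0 r1].
  exists (OS OZ); first exact: (ofin_lt_Om 1).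
  move=> s [_ [t [Tt [st _]]]]; exists t; last exact: leq_ltn_trans st.
  by rewrite expr0 mul1r subrr mul0r addr0.
have [be [bm an]] := next_stage T0 e0 (introT andP (conj r0 r1)) n00.
have [|N1 hN1] := @stage R T0 _ _ be e (ga m)
    (fun j => if (j < n0)%N then alpha j else OS OZ) n0.+1 bm e0 _ an.
  move=> j _; case: ifP => [jn|_]; last exact: oexp_gt0.
  by apply: ole_trans (hga j).2 _; apply: oexp_le; apply: hm; exact: ltnW.
have [|o olt_o ho] := IH (theta 1 * r + 3 * e).
  rewrite ec; apply/andP; split; first by apply: addr_ge0; apply: mulr_ge0 => //; lra.
  nra.
exists (omul (omul (oexp omega (ga m)) (ofin N1)) o).
  apply: oexpW_mulclosed => //; apply: olt_le_trans (oexp_mulfin_lt _ _) _.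
  by apply: oexp_le; apply/ole_SE; exact: (hga m).1.
move=> s /hN1 /ho[xs hxs sz]; exists xs => //; move: hxs.
rewrite ec (_ : _ + _ = theta 1 ^+ k.+1 * r + (1 - theta 1 ^+ k.+1) * c) //.
by rewrite exprS; move: (theta 1 ^+ k) => q; lra.
Qed.

Lemma tderiv_mono (T T' : set (seq (nat -> R))) b : T `<=` T' -> tderiv T b `<=` tderiv T' b.
Proof.
by move=> h; elim: b => [//|b IH|f IH s hs n]; [exact: tD_mono|exact: IH].
Qed.

Hypothesis alpha_sup : ole (OL alpha) Om.

Lemma Ib_upper K T : 1 <= K -> l1K_tree N K T ->
  tderiv T (oexp omega (omul (oexp omega xi) (ofin 2))) = set0.
Proof.
move=> K1 [Tne [Ttake Tnode]]; rewrite /= oadd0o oexpD -/Om.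
apply/seteqP; split=> // s0 hs0.
have [t0 t1] := andP (theta01 (ltn0Sn 0)).
(* With [q = theta 1 ^+ k < c], the final norm bound [q + (1 - q) * c] is below [2 * c = K^-1],
   against the l1 estimate. *)
pose c : R := K^-1 / 2; have K0 : 0 < K by lra.
have Ki : 0 < K^-1 by rewrite invr_gt0.
have Ki1 : K^-1 <= 1 by rewrite invf_le1.
pose e := (1 - theta 1) * c / 3.
have e0 : 0 < e by rewrite /e /c; apply: divr_gt0 => //; apply: mulr_gt0; lra.
have ec : 3 * e = (1 - theta 1) * c by rewrite /e; lra.
have [M hM] := theta_null e0.
pose n0 := maxn M 1.
have hn0 m : (n0 <= m)%N -> theta m <= e by rewrite geq_max => /andP[/hM/ltW].
have n00 : (0 < n0)%N by rewrite leq_max orbT.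
have cpos : 0 < c by rewrite /c divr_gt0.
have [k hk] := expr_small (theta01 (ltn0Sn 0)) cpos.
have cc : 0 <= c <= 1 by rewrite /c; lra.
have one : ((0 : R) <= 1) && ((1 : R) <= 1) by rewrite ler01 lexx.
have [o olt_o ho] := iterate_stages T e0 n00 cc ec k one.
have [be [bm an]] := first_stage T e0 hn0.
(* A single ordinal, [OL alpha], stands for the whole tail of families, hence the exponent omega^xi
   and the order [Om * N1]. *)
have [N1 hN1] := @stage R T good0 (good n0 e 1) be e (oexp omega xi) (fun=> OL alpha) 1%N bm e0
  (fun _ _ => alpha_sup) (fun t w m h1 h2 h3 => an t w m h1 h2 (fun B => h3 0%N B isT)).
have sub : T `<=` hull_tree T good0.
  move=> s Ts; have [h1 [h2 h3]] := Tnode _ Ts; split=> //.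
    by exists s => // i; exact: conv_nth.
  move=> i /h1[/vanishes_c00 hv e1]; split=> //.
  by rewrite /N in e1 *; rewrite e1.
have /hN1/ho[xs [_ [t Tt ct] gd] sz] :
    tderiv (hull_tree T good0) (omul (omul Om (ofin N1)) o) s0.
  apply: tderiv_le (tderiv_mono sub hs0); rewrite -omulA; apply: omul_le2l; apply: ole_ltW.
  by apply: oexpW_mulclosed => //; exact: ofin_lt_Om.
have [w [w0 w1 ex]] := ct 0%N sz; have [_ Nx _] := gd 0%N sz.
have [_ [_ /(_ w)]] := Tnode _ Tt.
rewrite (eq_bigr (fun i : 'I_(size t) => w i)); last by move=> i _; rewrite ger0_norm.
rewrite -(big_mkord predT w) w1 mulr1.
have -> : (fun k => \sum_(i < size t) w i * t`[i] k) = xs`[0].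
  by rewrite ex; apply/funext => j; rewrite /lincomb big_mkord.
move=> h; have : K^-1 <= theta 1 ^+ k * 1 + (1 - theta 1 ^+ k) * c by exact: le_trans h Nx.
have q0 : 0 < theta 1 ^+ k by rewrite exprn_gt0.
by move: hk; rewrite /c; move: (theta 1 ^+ k) q0 => q; nra.
Qed.

End UpperBound.

(** * The lower bound *)

Section Scales.
Local Open Scope nat_scope.
Variables (alpha : nat -> ord) (Psi : nat -> nat -> nat) (jn Cn : nat -> nat).
Hypothesis Psi_mono : forall n, {homo Psi n : v w / v <= w}.

(* The [n]-th family resolves limits with budgets [hn n f] on the [f]-th interval
   [start f, start f.+1). A member of an earlier family has at most [tau n f] points below
   [start f.+1], so a block of [Nn n f] points, with [Cn n >= 1 / theta n] and
   [theta 1 ^ jn n <= theta n], is far too long for [jn n] iterations of those families.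
   [Psi n] makes room for such blocks inside the [n]-th family itself. *)
Definition block_size n t f := Cn n * t.+1 ^ (jn n).+1 + f.+1.
Definition choice_bound n t f := Psi n (block_size n t f) + f.

(** Only earlier families enter, so the block lengths and the scale of the [n]-th family can be
    defined from [tau n] without circularity. *)
Fixpoint tau n f :=
  if n is n'.+1 then tau n' f + len (alpha n') (choice_bound n' (tau n' f) f) else 0.

Definition Nn n f := block_size n (tau n f) f.
Definition hn n f := choice_bound n (tau n f) f.

Lemma block_size_mono n t t' f f' : t <= t' -> f <= f' -> block_size n t f <= block_size n t' f'.
Proof. by move=> ht hf; rewrite leq_add // leq_mul // leq_exp2r. Qed.

Lemma tau_mono n : {homo tau n : f g / f <= g}.
Proof.
elim: n => [//|n IH] f g fg /=; rewrite leq_add ?IH //; apply: len_le.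
by rewrite leq_add // Psi_mono // block_size_mono ?IH.
Qed.

Lemma Nn_mono n : {homo Nn n : f g / f <= g}.
Proof. by move=> f g fg; rewrite block_size_mono ?tau_mono. Qed.

Lemma hn_mono n : {homo hn n : f g / f <= g}.
Proof. by move=> f g fg; rewrite leq_add // Psi_mono // Nn_mono. Qed.

Lemma Nn_gt n f : f < Nn n f.
Proof. by rewrite /Nn /block_size leq_addl. Qed.

Lemma len_tau m n f : m < n -> len (alpha m) (hn m f) <= tau n f.
Proof.
elim: n => [//|n IH]; rewrite ltnS leq_eqVlt => /orP[/eqP->|/IH h] /=.
  exact: leq_addl.
exact: leq_trans h (leq_addr _ _).
Qed.

(** The sum makes the [f]-th interval long enough for a block of each type [m <= f]. *)
Fixpoint start f := if f is f'.+1 then start f' + \sum_(0 <= m < f'.+1) Nn m f' else 0.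

Lemma start_Nn n f : n <= f -> start f + Nn n f <= start f.+1.
Proof. by move=> nf /=; rewrite leq_add2l; exact: (@leq_term_sum (fun m => Nn m f)). Qed.

Lemma start_lt f : start f < start f.+1.
Proof.
apply: leq_trans (start_Nn (leq0n f)); rewrite -addn1 leq_add2l.
exact: leq_ltn_trans (Nn_gt 0 f).
Qed.

Lemma start_mono : {homo start : f g / f <= g}.
Proof.
move=> f g /subnKC<-; elim: (g - f) => [|k IH]; first by rewrite addn0.
by rewrite addnS; apply: leq_trans IH (ltnW (start_lt _)).
Qed.

Fixpoint phi k := if k is k'.+1 then
  (if start (phi k').+1 <= k then (phi k').+1 else phi k') else 0.

Lemma phiP k : start (phi k) <= k < start (phi k).+1.
Proof.
elim: k => [|k /andP[h1 h2]]; first by rewrite (start_lt 0).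
have -> : phi k.+1 = if start (phi k).+1 <= k.+1 then (phi k).+1 else phi k by [].
case: (leqP (start (phi k).+1) k.+1) => h; last by rewrite (leqW h1) h.
have -> : k.+1 = start (phi k).+1 by apply/eqP; rewrite eqn_leq h2 h.
by rewrite leqnn start_lt.
Qed.

Lemma phi_eq f k : start f <= k < start f.+1 -> phi k = f.
Proof.
move=> /andP[h1 h2]; have /andP[h3 h4] := phiP k.
apply/eqP; rewrite eqn_leq; apply/andP; split; rewrite leqNgt; apply/negP => /start_mono h.
  by have := leq_trans h h3; rewrite leqNgt h2.
by have := leq_trans h h1; rewrite leqNgt h4.
Qed.

Lemma phi_mono : {homo phi : k l / k <= l}.
Proof.
move=> k l kl; rewrite leqNgt; apply/negP => /start_mono h.
have /andP[h1 _] := phiP k; have /andP[_ h2] := phiP l.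
by have := leq_trans (leq_trans h2 h) (leq_trans h1 kl); rewrite ltnn.
Qed.

Definition HH n k := hn n (phi k).

Lemma HH_mono n : {homo HH n : v w / v <= w}.
Proof. by move=> v w vw; apply/hn_mono/phi_mono. Qed.

Lemma hn_ge n f : f <= hn n f.
Proof. exact: leq_addl. Qed.

Lemma HH_start n f : f <= HH n (start f).
Proof. by rewrite /HH (@phi_eq f) ?leqnn ?start_lt // hn_ge. Qed.

Lemma HH_unb n v : exists k, v <= HH n k.
Proof. by exists (start v); exact: HH_start. Qed.

(** Blocks of different types on one interval start at the same point and overlap; configurations
    will use each interval at most once. *)
Definition blk n f := iota (start f) (Nn n f).

Lemma mem_blk n f k : n <= f -> k \in blk n f -> phi k = f.
Proof.
move=> nf; rewrite mem_iota => /andP[h1 h2]; apply: phi_eq; rewrite h1.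
exact: leq_trans h2 (start_Nn nf).
Qed.

Lemma blk_lt n f k : n <= f -> k \in blk n f -> k < start f.+1.
Proof.
move=> nf; rewrite mem_iota => /andP[h1 h2]; exact: leq_trans h2 (start_Nn nf).
Qed.

Lemma cov_below m n f (s : seq nat) : m < n -> all (fun k => k < start f.+1) s ->
  cov (alpha m) (map (HH m) s) -> size s <= tau n f.
Proof.
move=> mn h /cov_size hs; rewrite -(size_map (HH m)).
apply: leq_trans (len_tau f mn); apply: hs; rewrite all_map; apply: sub_all h => k kf /=.
by apply: hn_mono; rewrite -ltnS ltnNge; apply/negP => /start_mono h;
  have /andP[h1 _] := phiP k; have := leq_trans h h1; rewrite leqNgt kf.
Qed.

(** All points of a block share one budget, equal to the length of the block, so an [alpha i]-cover
    by block lengths expands to a cover of [omega * alpha i] by points. Domination through [Psi n],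
    built into the scale, turns it into an [alpha n]-cover. *)
Lemma cov_blocks i n fs : dominates (Psi n) (omul omega (alpha i)) (alpha n) ->
  sorted ltn fs -> all (leq n) fs -> cov (alpha i) (map (Nn n) fs) ->
  sorted ltn (flatten (map (blk n) fs)) /\
  cov (alpha n) (map (HH n) (flatten (map (blk n) fs))).
Proof.
move=> dom sfs nfs cfs.
have sb : sorted ltn (flatten (map (blk n) fs)).
  elim: fs sfs nfs {cfs} => [//|f fs IH] /= pf /andP[nf nfs].
  apply: sorted_cat_ltn; [exact: iota_ltn_sorted|exact: IH (path_sorted pf) nfs|].
  move=> k l kf /flattenP[_ /mapP[g gfs ->]] lg.
  have fg : f < g by move: pf => /(order_path_min ltn_trans)/allP; exact.
  apply: leq_trans (blk_lt nf kf) (leq_trans (start_mono fg) _).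
  by move: lg; rewrite mem_iota => /andP[].
split=> //.
have e : flatten [seq nseq p.1 p.2 | p <- [seq (Nn n f, Nn n f) | f <- fs]] =
    map (fun k => Nn n (phi k)) (flatten (map (blk n) fs)).
  elim: fs nfs {sfs cfs sb} => [//|f fs IH] /= /andP[nf /IH ->]; rewrite map_cat; congr (_ ++ _).
  have /all_pred1P : all (pred1 (Nn n f)) [seq Nn n (phi k) | k <- blk n f].
    by apply/allP => v /mapP[k /(mem_blk nf) ek ->] /=; rewrite ek.
  by rewrite size_map size_iota.
have := @cov_omul_omega (alpha i) [seq (Nn n f, Nn n f) | f <- fs].
rewrite e -map_comp => /(_ _ cfs) h.
have {}h : cov (omul omega (alpha i)) (map (fun k => Nn n (phi k)) (flatten (map (blk n) fs))).
  apply: h; rewrite all_map; apply/allP => f _ /=; rewrite leqnn andbT.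
  exact: leq_ltn_trans (Nn_gt n f).
have sl : sorted leq (map (fun k => Nn n (phi k)) (flatten (map (blk n) fs))).
  by apply: homo_sorted sb => k l /ltnW kl; apply/Nn_mono/phi_mono.
have := dom _ sl h; rewrite -map_comp; apply: cov_le; apply: all2_map_leq => k _ /=.
exact: leq_addr.
Qed.

End Scales.

(** * Norms of averages over blocks *)

Section LowerBound.
Variables (R : realType) (alpha : nat -> ord) (theta : nat -> R).
Variables (Psi : nat -> nat -> nat) (jn Cn : nat -> nat).
Hypothesis Psi_mono : forall n, {homo Psi n : v w / (v <= w)%N}.
Hypothesis theta01 : forall m, (0 < m)%N -> 0 < theta m < 1.
Hypothesis theta_dec : forall n, (0 < n)%N -> theta n.+1 <= theta n.
Hypothesis jnP : forall n, (0 < n)%N -> theta 1 ^+ jn n <= theta n.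
Hypothesis CnP : forall n, (0 < n)%N -> (theta n)^-1 <= (Cn n)%:R.
Implicit Types (x y z : nat -> R).

Let H := HH alpha Psi jn Cn.
Let tau := tau alpha Psi jn Cn.
Let Nn := Nn alpha Psi jn Cn.
Let start := start alpha Psi jn Cn.
Let phi := phi alpha Psi jn Cn.
Let blk := blk alpha Psi jn Cn.
Let F n := Fam (H n) (alpha n).
Let N := Tnorm (F 0) F theta.

Let Hm n : {homo H n : v w / (v <= w)%N}. Proof. exact: HH_mono. Qed.
Let Ffin m A : F m A -> finite_set A. Proof. exact: (F_fin Hm). Qed.
Let F0 m : F m set0. Proof. exact: F_0. Qed.
Let F0' m : (0 < m)%N -> F m set0. Proof. by []. Qed.

Lemma theta_anti m n : (0 < m <= n)%N -> theta n <= theta m.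
Proof.
move=> /andP[m0 /subnKC <-]; elim: (n - m)%N => [|k IH]; first by rewrite addn0.
by rewrite addnS; apply: le_trans IH; apply: theta_dec; rewrite addn_gt0 m0.
Qed.

Definition inside n f x := forall k, x k != 0 -> k \in blk n f.

Lemma inside_vanishes n f x : (n <= f)%N -> inside n f x -> vanishes_from (start f.+1) x.
Proof.
move=> nf h k; apply: contraTeq => /h /(blk_lt nf); by rewrite -ltnNge.
Qed.

Lemma count_small m n f (q : seq nat) x : (m < n)%N -> (n <= f)%N ->
  inside n f x -> (forall k, `|x k| <= 1) -> sorted ltn q -> F m [set k | k \in q] ->
  \sum_(k <- q) `|x k| <= (tau n f)%:R.
Proof.
move=> mn nf ins x1 sq /(Fam_seq _ _ sq) cq.
pose P k := (k < start f.+1)%N.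
rewrite (sum_filter_supp q (P := P)); last first.
  by move=> k; rewrite /P -leqNgt => /(inside_vanishes nf ins) ->; rewrite normr0.
apply: (@le_trans _ _ (size [seq k <- q | P k])%:R).
  rewrite -sum1_size natr_sum; exact: ler_sum.
rewrite ler_nat; apply: (cov_below Psi_mono mn); first exact: filter_all.
apply: cov_subseq cq; first exact: sorted_map_H.
exact/map_subseq/filter_subseq.
Qed.

Definition meets (E : set nat) x := exists2 a, E a & x a != 0.

Lemma count_meeting m n f Es x : (m < n)%N -> (n <= f)%N -> inside n f x -> admissible (F m) Es ->
  (size [seq i <- iota 0 (size Es) |
     `[< meets (nth set0 Es i) x >]] <= tau n f)%N.
Proof.
move=> mn nf ins [ne [su ad]]; set q := [seq i <- _ | _].
have sq : sorted ltn q by apply: (sorted_filter ltn_trans); exact: iota_ltn_sorted.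
have hq i : i \in q -> (i < size Es)%N /\ meets (nth set0 Es i) x.
  by rewrite mem_filter mem_iota => /andP[/asboolP h /andP[_ h']].
have /choice[e he] : forall i, exists e, i \in q -> is_min e (nth set0 Es i) /\ (e < start f.+1)%N.
  move=> i; case: (boolP (i \in q)) => [/hq[_ [a Ea xa]]|_]; last by exists 0%N.
  have ex : exists e, `[< nth set0 Es i e >] by exists a; apply/asboolP.
  have := ex_minnP ex; case=> e /asboolP Ee emin; exists e => _; split.
    by split=> // k Ek; apply: emin; apply/asboolP.
  by apply: leq_ltn_trans (blk_lt nf (ins _ xa)); apply: emin; apply/asboolP.
have se : sorted ltn (map e q).
  rewrite sorted_map; apply: (sub_in_sorted (P := mem q)) sq; last exact/allP.
  move=> i j iq jq ij /=; apply: (su i j); first by apply/andP; split=> //; case: (hq j jq).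
    by case: (he i iq) => [[]].
  by case: (he j jq) => [[]].
rewrite -(size_map e); apply: (cov_below Psi_mono mn).
  by rewrite all_map; apply/allP => i /he[].
apply/(Fam_seq (H m) (alpha m) se); apply: (Fam_hereditary (@Hm m)) ad _ => k /mapP[i iq ->].
by exists i; split; [case: (hq i iq)|case: (he i iq)].
Qed.

(* Cut the norming tree at depth [i]: the leaves reached using only the families before
   the [n]-th one are few, everything else carries a factor [theta 1 ^+ i] or [theta n]. *)
Lemma flat_norm n f i x : (0 < n <= f)%N -> inside n f x -> (forall k, `|x k| <= 1) ->
  N x <= Num.max (theta 1 ^+ i) (theta n) * l1 (start f.+1) x + (tau n f).+1%:R ^+ i.+1.
Proof.
move=> /andP[n0 nf]; have [t10 t11] := andP (theta01 (ltn0Sn 0)).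
have [tn0 tn1] := andP (theta01 n0).
elim: i x => [|i IH] x ins x1; have vx := inside_vanishes nf ins.
  apply: le_trans (Tnorm_l1 (@Ffin 0) (F0 0) F0' theta01 vx) _.
  by rewrite expr0 (max_l (ltW tn1)) mul1r lerDl exprn_ge0.
set M := Num.max _ _; set T := (tau n f).+1%:R.
have T1 : 1 <= T :> R by rewrite ler1n.
have M0 : 0 <= M by rewrite le_max exprn_ge0 ?ltW.
have l0 : 0 <= M * l1 (start f.+1) x by rewrite mulr_ge0 ?l1_ge0.
have TT : (tau n f)%:R * T ^+ i.+1 <= T ^+ i.+2.
  by rewrite [in leRHS]exprS ler_wpM2r ?ler_nat ?exprn_ge0 // (le_trans _ T1).
have T2 : T <= T ^+ i.+2 by rewrite ler_eXnr.
apply: (Tnorm_le (@Ffin 0) (F0 0) F0' theta01 vx).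
- by move=> k; apply: le_trans (x1 k) _; lra.
- move=> q sq Fq; apply: le_trans (count_small n0 nf ins x1 sq Fq) _.
  apply: (@le_trans _ _ T); first by rewrite ler_nat.
  by apply: le_trans T2 _; lra.
- move=> m Es m0 ad; have [tm0 tm1] := andP (theta01 m0).
  have su : successive Es by case: ad => _ [].
  case: (leqP n m) => nm.
    apply: (@le_trans _ _ (M * l1 (start f.+1) x)); last by rewrite lerDl exprn_ge0 // (le_trans _ T1).
    apply: ler_pM; first exact: ltW.
    + apply: sumr_ge0 => E _; exact: (Tnorm_ge0 (@Ffin 0) (F0 0) F0' theta01 (vanishes_restr E vx)).
    + by rewrite le_max theta_anti ?n0 ?nm // orbT.
    apply: le_trans (sum_l1_restr (start f.+1) x su); apply: ler_sum => E _.
    exact: (Tnorm_l1 (@Ffin 0) (F0 0) F0' theta01 (vanishes_restr E vx)).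
  set M' := Num.max (theta 1 ^+ i) (theta n) in IH.
  have M'0 : 0 <= M' by rewrite le_max exprn_ge0 ?ltW.
  pose P j := `[< meets (nth set0 Es j) x >].
  have le : \sum_(E <- Es) N (restr E x) <= M' * l1 (start f.+1) x + (tau n f)%:R * T ^+ i.+1.
    (* The additive error is charged only to sets that meet [x]. There are at most [tau n f] of
       them, which costs one more power of [tau n f + 1]. *)
    apply: (@le_trans _ _ (\sum_(0 <= j < size Es)
        (M' * l1 (start f.+1) (restr (nth set0 Es j) x) + (if P j then T ^+ i.+1 else 0)))).
      rewrite (big_nth set0); apply: ler_sum => j _; rewrite /P; case: asboolP => [_|no].
        apply: IH => [k|k]; rewrite /restr; case: ifP => _ //; rewrite ?eqxx // ?normr0 //.
        exact: ins.
      rewrite addr0; apply: (@le_trans _ _ 0); last by rewrite mulr_ge0 ?l1_ge0.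
      apply: (@Tnorm_restr0 _ alpha H theta Hm theta01) => k Ek; apply/eqP; apply: contrapT => /negP xk.
      by apply: no; exists k.
    rewrite big_split /= -mulr_sumr; apply: lerD.
      by apply: ler_wpM2l => //; have := sum_l1_restr (start f.+1) x su; rewrite (big_nth set0).
    rewrite -big_mkcond -big_filter /= big_const_seq count_predT iter_addr_0 -[leLHS]mulr_natl.
    rewrite ler_wpM2r ?exprn_ge0 ?ler_nat //.
    by have := count_meeting nm nf ins ad; rewrite /index_iota subn0.
  apply: le_trans (_ : _ <= theta m * (M' * l1 (start f.+1) x) + T ^+ i.+2) _.
    apply: le_trans (_ : _ <= theta m * (M' * l1 (start f.+1) x + (tau n f)%:R * T ^+ i.+1)) _.
      by rewrite ler_pM2l.
    rewrite mulrDr lerD2l; apply: le_trans TT; apply: ler_piMl; last exact: ltW.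
    by rewrite mulr_ge0 // exprn_ge0 // (le_trans _ T1).
  rewrite lerD2r mulrA ler_wpM2r ?l1_ge0 //.
  apply: le_trans (_ : _ <= theta 1 * M') _.
    by rewrite ler_wpM2r // theta_anti.
  rewrite /M' /M; have [h|h] := leP (theta 1 ^+ i) (theta n).
    by rewrite le_max; apply/orP; right; rewrite ler_piMl // ltW.
  by rewrite le_max exprS lexx.
Qed.

Definition ind n f : nat -> R := fun k => (k \in blk n f)%:R.
Definition nu n f := N (ind n f).
Definition yv n f : nat -> R := fun k => ind n f k / nu n f.

Lemma ind_inside n f : inside n f (ind n f).
Proof. by move=> k; rewrite /ind; case: (k \in _) => //; rewrite eqxx. Qed.

Lemma ind_le1 n f k : `|ind n f k| <= 1.
Proof. by rewrite /ind; case: (k \in _); rewrite ?normr1 ?normr0 ?ler01. Qed.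

Lemma ind_vanishes n f : (n <= f)%N -> vanishes_from (start f.+1) (ind n f).
Proof. by move=> nf; apply: inside_vanishes nf (@ind_inside n f). Qed.

Lemma sum_blk (c : R) n f : \sum_(k <- blk n f) c = (Nn n f)%:R * c.
Proof. by rewrite big_const_seq count_predT size_iota iter_addr_0 mulr_natl. Qed.

Lemma l1_ind n f : (n <= f)%N -> l1 (start f.+1) (ind n f) = (Nn n f)%:R.
Proof.
move=> nf; rewrite -[RHS]mulr1 -sum_blk /l1.
transitivity (\sum_(0 <= k < start f.+1) (if k \in blk n f then 1 else 0) : R).
  by apply: eq_bigr => k _; rewrite /ind; case: (k \in _); rewrite ?normr1 ?normr0.
rewrite -big_mkcond -big_filter; apply: perm_big; apply: uniq_perm; rewrite ?filter_uniq ?iota_uniq //.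
move=> k; rewrite mem_filter mem_index_iota; case: (boolP (k \in blk n f)) => //= h.
exact: (blk_lt nf h).
Qed.

Lemma start_blk n f : start f \in blk n f.
Proof.
rewrite mem_iota leqnn /= -[ltnLHS]addn0 ltn_add2l; exact: leq_ltn_trans (Nn_gt _ _ _ _ n f).
Qed.

Lemma nu_ge1 n f : (n <= f)%N -> 1 <= nu n f.
Proof.
move=> nf; apply: le_trans (coord_Tnorm (@Ffin 0) (F0 0) F0' theta01 (start f) (ind_vanishes nf)).
by rewrite /ind start_blk normr1.
Qed.

(** At depth [jn n] the main term of [flat_norm] is at most [theta n * Nn n f] by the choice of
    [jn], and so is the error term by the choice of [Cn]; hence the constant 2. *)
Lemma nu_le n f : (0 < n <= f)%N -> nu n f <= 2 * theta n * (Nn n f)%:R.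
Proof.
move=> nf; have [n0 nf'] := andP nf; have [t0 t1] := andP (theta01 n0).
apply: le_trans (flat_norm (jn n) nf (@ind_inside n f) (@ind_le1 n f)) _.
rewrite (max_r (jnP n0)) l1_ind //.
suff : (tau n f).+1%:R ^+ (jn n).+1 <= theta n * (Nn n f)%:R by lra.
have h : (theta n)^-1 * (tau n f).+1%:R ^+ (jn n).+1 <= (Nn n f)%:R.
  apply: le_trans (_ : _ <= (Cn n)%:R * (tau n f).+1%:R ^+ (jn n).+1) _.
    by rewrite ler_wpM2r ?exprn_ge0 ?CnP.
  by rewrite -natrX -natrM ler_nat leq_addr.
by move: h; rewrite mulrC ler_pdivrMr // mulrC.
Qed.

Lemma yv_inside n f : inside n f (yv n f).
Proof.
move=> k h; apply: ind_inside; apply: contraNneq h; by rewrite /yv => ->; rewrite mul0r.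
Qed.

Lemma yv_vanishes n f : (n <= f)%N -> vanishes_from (start f.+1) (yv n f).
Proof. by move=> nf; apply: inside_vanishes nf (@yv_inside n f). Qed.

Lemma yv_norm n f : (n <= f)%N -> N (yv n f) = 1.
Proof.
move=> nf; have nu1 := nu_ge1 nf; have nu0 : 0 < nu n f by exact: lt_le_trans nu1.
have nui : 0 < (nu n f)^-1 by rewrite invr_gt0.
apply/eqP; rewrite eq_le; apply/andP; split.
  have := Tnorm_scale_le (@Ffin 0) (F0 0) F0' theta01 (z := yv n f) (ltW nui) (ind_vanishes nf).
  rewrite -/(nu n f) mulVf ?gt_eqF //; apply=> k.
  by rewrite /yv normrM (gtr0_norm nui) mulrC.
have h : nu n f <= nu n f * N (yv n f).
  apply: (Tnorm_scale_le (@Ffin 0) (F0 0) F0' theta01 (ltW nu0) (yv_vanishes nf)) => k.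
  by rewrite /yv normrM (gtr0_norm nui) mulrCA divff ?mulr1 // gt_eqF.
by move: h; rewrite -[leLHS]mulr1 ler_pM2l.
Qed.

Lemma yv_mass n f : (0 < n <= f)%N -> 1 <= 2 * theta n * \sum_(a <- blk n f) `|yv n f a|.
Proof.
move=> nf; have [n0 nf'] := andP nf.
have nu0 : 0 < nu n f by exact: lt_le_trans (nu_ge1 nf').
have -> : \sum_(a <- blk n f) `|yv n f a| = (Nn n f)%:R / nu n f.
  rewrite -sum_blk !big_seq; apply: eq_bigr => a h.
  by rewrite /yv /ind h mul1r gtr0_norm // invr_gt0.
by rewrite mulrA ler_pdivlMr // mul1r nu_le.
Qed.

Lemma singles_norm m (S : seq nat) z n : (0 < m)%N -> sorted ltn S -> F m [set k | k \in S] ->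
  vanishes_from n z -> theta m * \sum_(a <- S) `|z a| <= N z.
Proof.
move=> m0 sS FS vz; pose Es := [seq [set a] | a <- S].
have nthE i : (i < size S)%N -> nth set0 Es i = [set nth 0%N S i].
  by move=> h; rewrite (nth_map 0%N).
have ad : admissible (F m) Es.
  rewrite /admissible size_map; split; [|split].
  - by move=> i h; rewrite nthE //; split; [exact: finite_set1|exists (nth 0%N S i)].
  - move=> i j /andP[ij js] a b; rewrite !nthE ?(ltn_trans ij js) //= => -> ->.
    by apply: (sorted_ltn_nth ltn_trans 0%N sS); rewrite ?inE ?(ltn_trans ij js).
  - apply: (Fam_hereditary (@Hm m)) FS _ => k [i [h]]; rewrite nthE // => -[/= -> _].
    exact: mem_nth.
apply: le_trans (Tnorm_step (@Ffin 0) (F0 0) F0' theta01 m0 vz ad).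
rewrite ler_wpM2l ?big_map //; first by case/andP: (theta01 m0) => /ltW.
apply: ler_sum => a _.
have := coord_Tnorm (@Ffin 0) (F0 0) F0' theta01 a (vanishes_restr [set a] vz).
by rewrite /restr mem_set.
Qed.

(** * Groups of blocks and their l1-nodes *)

Hypothesis PsiP : forall i n, (i <= n)%N -> ole (omul omega (alpha i)) (alpha n) ->
  dominates (Psi n) (omul omega (alpha i)) (alpha n).

(* A group [((n, i), fs)] stands for the vectors [yv n f], [f \in fs], whose supports
   together form a member of [F n]; [i] bounds the order of the tree of such groups. *)
Definition group := (nat * nat * seq nat)%type.
Implicit Types (g : group) (gs : seq group).

Definition gok g := [/\ (0 < g.1.1)%N, (g.1.2 <= g.1.1)%N,
  ole (omul omega (alpha g.1.2)) (alpha g.1.1), g.2 <> [::] &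
  all (leq g.1.1) g.2 /\ cov (alpha g.1.2) (map (Nn g.1.1) g.2)].

Definition config gs := (forall g, g \in gs -> gok g) /\ sorted ltn (flatten (map snd gs)).
Definition gset g : seq nat := flatten (map (blk g.1.1) g.2).
Definition gmin g : nat := start (head 0%N g.2).
Definition items gs : seq (nat * nat) := flatten [seq [seq (g.1.1, f) | f <- g.2] | g <- gs].
Definition node gs : seq (nat -> R) := [seq yv p.1 p.2 | p <- items gs].

Lemma sorted_flatten_nth (ss : seq (seq nat)) i j a b : sorted ltn (flatten ss) ->
  (i < j < size ss)%N -> a \in nth [::] ss i -> b \in nth [::] ss j -> (a < b)%N.
Proof.
elim: ss i j => [|s ss IH] i j /=; first by move=> _ /andP[].
rewrite (sorted_pairwise ltn_trans) pairwise_cat -!(sorted_pairwise ltn_trans).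
move=> /and3P[/allrelP h _ sss]; case: j => [|j]; first by case/andP.
case: i => [|i]; last exact: IH.
rewrite ltnS /= => js ha hb; apply: h => //; apply/flattenP; exists (nth [::] ss j) => //.
exact: mem_nth.
Qed.

Lemma sorted_flatten_mem (ss : seq (seq nat)) s : sorted ltn (flatten ss) -> s \in ss ->
  sorted ltn s.
Proof.
elim: ss => [//|s' ss IH] /=.
rewrite (sorted_pairwise ltn_trans) pairwise_cat -!(sorted_pairwise ltn_trans).
by move=> /and3P[_ h1 /IH h2]; rewrite in_cons => /orP[/eqP->|].
Qed.

Lemma items_snd gs : map snd (items gs) = flatten (map snd gs).
Proof.
rewrite /items map_flatten -map_comp; congr flatten; apply: eq_map => g /=.
by rewrite -map_comp map_id_in.
Qed.

Lemma items_ok gs p : config gs -> p \in items gs -> (0 < p.1 <= p.2)%N.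
Proof.
move=> [ok _] /flattenP[_ /mapP[g /ok[n0 _ _ _ [/allP h _]] ->] /mapP[f /h fn ->]] /=.
by rewrite n0.
Qed.

Lemma flatten_blk_items gs : flatten (map gset gs) = flatten [seq blk p.1 p.2 | p <- items gs].
Proof.
rewrite /items; elim: gs => [//|g gs IH] /=.
rewrite map_cat flatten_cat -IH; congr (_ ++ _); rewrite /gset -map_comp; congr flatten.
Qed.

Lemma sorted_blk_items (ps : seq (nat * nat)) : all (fun p => p.1 <= p.2)%N ps ->
  sorted ltn (map snd ps) -> sorted ltn (flatten [seq blk p.1 p.2 | p <- ps]).
Proof.
elim: ps => [//|p ps IH] /= /andP[hp hps] pf.
apply: sorted_cat_ltn; [exact: iota_ltn_sorted|exact: IH hps (path_sorted pf)|].
move=> k l kf /flattenP[_ /mapP[q qps ->]] lq.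
have fg : (p.2 < q.2)%N.
  by move: pf => /(order_path_min ltn_trans)/allP; apply; exact: map_f.
apply: leq_trans (blk_lt hp kf) (leq_trans (start_mono alpha Psi jn Cn fg) _).
by move: lq; rewrite mem_iota => /andP[].
Qed.

Lemma sorted_gsets gs : config gs -> sorted ltn (flatten (map gset gs)).
Proof.
move=> cf; rewrite flatten_blk_items; apply: sorted_blk_items.
  by apply/allP => p /(items_ok cf)/andP[].
by rewrite items_snd; case: cf.
Qed.

Lemma gset_F g gs : config gs -> g \in gs -> sorted ltn (gset g) /\ F g.1.1 [set k | k \in gset g].
Proof.
move=> [ok so] gin; have [n0 in' le ne [nfs cv]] := ok g gin.
have sg : sorted ltn g.2 by apply: sorted_flatten_mem so _; exact: map_f.
have [h1 h2] := cov_blocks Psi_mono (PsiP in' le) sg nfs cv.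
by split=> //; exact/(Fam_seq (H g.1.1) (alpha g.1.1) h1).
Qed.

Lemma gmin_gset g : gok g -> gmin g \in gset g.
Proof.
move=> [_ _ _ ne _]; rewrite /gmin /gset; case: (g.2) ne => [//|f fs] _ /=.
by rewrite mem_cat start_blk.
Qed.

Lemma gmin_le g gs k : config gs -> g \in gs -> k \in gset g -> (gmin g <= k)%N.
Proof.
move=> [ok so] gin; have [n0 in' le ne [nfs cv]] := ok g gin.
have sg : sorted ltn g.2 by apply: sorted_flatten_mem so _; exact: map_f.
rewrite /gmin /gset => /flattenP[_ /mapP[f fin ->]]; rewrite mem_iota => /andP[h _].
apply: leq_trans h; apply: start_mono; case: (g.2) fin sg => [//|f' fs] /=.
rewrite in_cons => /orP[/eqP->//|fin] /(order_path_min ltn_trans)/allP/(_ _ fin); exact: ltnW.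
Qed.

Lemma groups_admissible k gs : config gs -> cov (alpha k) (map (H k) (map gmin gs)) ->
  admissible (F k) [seq [set a | a \in gset g] | g <- gs].
Proof.
move=> cf cv; have sg := sorted_gsets cf; have ok := cf.1.
pose g0 : group := (0%N, 0%N, [::]).
have nthE i : (i < size gs)%N -> nth set0 [seq [set a | a \in gset g] | g <- gs] i =
    [set a | a \in gset (nth g0 gs i)].
  by move=> h; rewrite (nth_map g0).
have nthG i : (i < size gs)%N -> gset (nth g0 gs i) = nth [::] (map gset gs) i.
  by move=> h; rewrite (nth_map g0).
rewrite /admissible size_map; split; [|split].
- move=> i h; rewrite nthE //; split; first exact: finite_seq.
  exists (gmin (nth g0 gs i)) => /=; apply/gmin_gset/ok; exact: mem_nth.
- move=> i j /andP[ij js] a b; rewrite !nthE ?(ltn_trans ij js) //= => ha hb.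
  apply: (sorted_flatten_nth sg (i := i) (j := j)); rewrite ?size_map ?ij //.
    by rewrite -nthG // (ltn_trans ij js).
  by rewrite -nthG.
- have sm : sorted ltn (map gmin gs).
    rewrite (sorted_pairwise ltn_trans); apply/(pairwiseP 0%N) => i j.
    rewrite !inE !size_map => hi hj ij; rewrite !(nth_map g0) //.
    apply: (sorted_flatten_nth sg (i := i) (j := j)); rewrite ?size_map ?ij //.
      by rewrite -nthG //; apply/gmin_gset/ok; exact: mem_nth.
    by rewrite -nthG //; apply/gmin_gset/ok; exact: mem_nth.
  have : F k [set x | x \in map gmin gs] by exact/(Fam_seq (H k) (alpha k) sm).
  move=> /(Fam_hereditary (@Hm k)); apply=> e [i [h]]; rewrite nthE // => -[/= e1 e2].
  apply/mapP; exists (nth g0 gs i); first exact: mem_nth.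
  apply/eqP; rewrite eqn_leq (gmin_le cf (mem_nth _ h) e1) andbT; apply: e2.
  by apply/gmin_gset/ok; exact: mem_nth.
Qed.

Local Notation "s '`[' i ']'" := (nth (@vzero R) s i) (at level 2, format "s `[ i ]").

(** The norm is used at two levels. [F k] separates the groups at the price [theta k]; inside a
    group, [F n] norms the points as singletons with factor [theta n], which cancels against the
    l1-norm of [yv n f], at least [1 / (2 * theta n)]. *)
Lemma node_l1 k gs : (0 < k)%N -> config gs -> cov (alpha k) (map (H k) (map gmin gs)) ->
  l1K_node N (2 / theta k) (node gs).
Proof.
move=> k0 cf cv; have sI : sorted ltn (map snd (items gs)) by rewrite items_snd; case: cf.
pose it q := nth (0%N, 0%N) (items gs) q.
have szn : size (node gs) = size (items gs) by rewrite size_map.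
have nE q : (q < size (items gs))%N -> (node gs)`[q] = yv (it q).1 (it q).2.
  by move=> h; rewrite (nth_map (0%N, 0%N)).
have iok q : (q < size (items gs))%N -> (0 < (it q).1 <= (it q).2)%N.
  by move=> h; apply: items_ok cf _; exact: mem_nth.
have ilt q q' : (q < q')%N -> (q' < size (items gs))%N -> ((it q).2 < (it q').2)%N.
  move=> qq h; have := sorted_ltn_nth ltn_trans 0%N sI.
  move=> /(_ q q'); rewrite !inE size_map h (ltn_trans qq h) => /(_ isT isT qq).
  by rewrite !(nth_map (0%N, 0%N)) // (ltn_trans qq h).
split; [|split].
- move=> q; rewrite szn => h; rewrite nE //; have [_ nf] := andP (iok q h); split.
    exact: c00_vanishes (yv_vanishes nf).
  exact: yv_norm.
- move=> q q' /andP[qq]; rewrite szn => h a b; rewrite !nE ?(ltn_trans qq h) // => /yv_inside ha /yv_inside hb.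
  have [_ nf] := andP (iok q (ltn_trans qq h)).
  apply: leq_trans (blk_lt nf ha) (leq_trans (start_mono alpha Psi jn Cn (ilt _ _ qq h)) _).
  by move: hb; rewrite mem_iota => /andP[].
move=> c; rewrite szn; set x := (fun j : nat => _).
have xE q a : (q < size (items gs))%N -> a \in blk (it q).1 (it q).2 ->
    x a = c q * yv (it q).1 (it q).2 a.
  move=> h ha; rewrite /x (bigD1 (Ordinal h)) //= nE // big1 ?addr0 // => q' q'q.
  rewrite nE //; have [_ nf] := andP (iok q h); have [_ nf'] := andP (iok q' (ltn_ord q')).
  have [->|/yv_inside ha'] := eqVneq (yv (it q').1 (it q').2 a) 0; first by rewrite mulr0.
  have := mem_blk nf ha; rewrite (mem_blk nf' ha') => e.
  have [lt|lt|e'] := ltngtP q' q.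
  + by have := ilt _ _ lt h; rewrite e ltnn.
  + by have := ilt _ _ lt (ltn_ord q'); rewrite e ltnn.
  + by case/eqP: q'q; exact: val_inj.
have [n vx] : exists n, vanishes_from n x.
  exists (\max_(q < size (items gs)) start (it q).2.+1)%N => a ha; rewrite /x big1 // => q _.
  have [_ nf] := andP (iok q (ltn_ord q)); rewrite nE // (yv_vanishes nf) ?mulr0 //.
  by apply: leq_trans ha; exact: (leq_bigmax q).
pose G (p : nat * nat) := 2 * theta p.1 * \sum_(a <- blk p.1 p.2) `|x a|.
have cG q : (q < size (items gs))%N -> `|c q| <= G (it q).
  move=> h; rewrite /G; have -> : \sum_(a <- blk (it q).1 (it q).2) `|x a| =
      `|c q| * \sum_(a <- blk (it q).1 (it q).2) `|yv (it q).1 (it q).2 a|.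
    by rewrite mulr_sumr !big_seq; apply: eq_bigr => a /(xE q a h) ->; rewrite normrM.
  by rewrite mulrCA ler_peMr // yv_mass // iok.
have [t0 t1] := andP (theta01 k0).
rewrite invf_div mulrAC ler_pdivrMr // mulrC.
apply: (@le_trans _ _ (theta k * \sum_(p <- items gs) G p)).
  rewrite mulrC ler_pM2l // (big_nth (0%N, 0%N)) big_mkord; apply: ler_sum => q _.
  exact: cG.
rewrite big_flatten big_map.
have le g : g \in gs -> \sum_(p <- [seq (g.1.1, f) | f <- g.2]) G p <=
    2 * N (restr [set a | a \in gset g] x).
  move=> gin; have [sg Fg] := gset_F cf gin; have [n0 _ _ _ _] := cf.1 g gin.
  rewrite big_map /G /= -mulr_sumr -mulrA ler_pM2l //.
  apply: le_trans (singles_norm n0 sg Fg (vanishes_restr _ vx)).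
  rewrite /gset big_flatten big_map ler_wpM2l //; first by case/andP: (theta01 n0) => /ltW.
  rewrite [leLHS]big_seq [leRHS]big_seq; apply: ler_sum => f fin.
  rewrite [leLHS]big_seq [leRHS]big_seq; apply: ler_sum => a ain.
  rewrite /restr mem_set //=; apply/flattenP; exists (blk g.1.1 f) => //; exact: map_f.
apply: le_trans (_ : _ <= theta k * \sum_(g <- gs) 2 * N (restr [set a | a \in gset g] x)) _.
  by rewrite ler_pM2l // [leLHS]big_seq [leRHS]big_seq; apply: ler_sum.
rewrite -mulr_sumr mulrCA mulrC ler_pM2r //.
have := Tnorm_step (@Ffin 0) (F0 0) F0' theta01 k0 vx (groups_admissible cf cv).
by rewrite big_map.
Qed.

(** * Orders of the trees of configurations *)

Variable k : nat.
Hypothesis k_gt0 : (0 < k)%N.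

Definition node_tree : set (seq (nat -> R)) := [set s | l1K_node N (2 / theta k) s].

(** The part [c] of [alpha k] is still available for further groups. The threshold [k0] defers the
    choices at limits until the budgets are large enough; [open_inner] does the same within a
    group. *)
Definition open_outer gs c := exists k0, forall us, sorted leq us -> all (leq k0) us ->
  cov c us -> cov (alpha k) (map (H k) (map gmin gs) ++ us).

Definition open_inner i n fs d := exists k0, forall us, sorted leq us -> all (leq k0) us ->
  cov d us -> cov (alpha i) (map (Nn n) fs ++ us).

Lemma tderiv_OS_intro (T : set (seq (nat -> R))) b s u : u <> [::] ->
  tderiv T b s -> tderiv T b (s ++ u) -> tderiv T (OS b) s.
Proof.
move=> ne h1 h2; split=> //; exists (s ++ u); split=> //; split; last by rewrite take_size_cat.
by rewrite size_cat -[ltnLHS]addn0 ltn_add2l; case: u ne {h2}.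
Qed.

Lemma node_rcons gs g : node (rcons gs g) = node gs ++ [seq yv g.1.1 f | f <- g.2].
Proof.
by rewrite /node /items -cats1 map_cat flatten_cat map_cat /= cats0 -map_comp.
Qed.

Lemma flatten_rcons gs g : flatten (map snd (rcons gs g)) = flatten (map snd gs) ++ g.2.
Proof. by rewrite -cats1 map_cat flatten_cat /= cats0. Qed.

Lemma config_rcons gs g : config gs -> gok g -> sorted ltn (flatten (map snd gs) ++ g.2) ->
  config (rcons gs g).
Proof.
move=> [h1 _] ok so; split; last by rewrite flatten_rcons.
by move=> g'; rewrite mem_rcons in_cons => /orP[/eqP->|/h1].
Qed.

Lemma config_rconsK gs g : config (rcons gs g) -> config gs.
Proof.
move=> [h1 h2]; split; first by move=> g' h; apply: h1; rewrite mem_rcons in_cons h orbT.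
move: h2; rewrite flatten_rcons !(sorted_pairwise ltn_trans) pairwise_cat.
by case/and3P.
Qed.

Lemma open_outer_le gs c : open_outer gs (OS c) -> open_outer gs c.
Proof. by move=> [k0 h]; exists k0 => us su au cu; apply: h => //; exact: cov_OS. Qed.

Lemma open_inner_le i n fs d : open_inner i n fs (OS d) -> open_inner i n fs d.
Proof. by move=> [k0 h]; exists k0 => us su au cu; apply: h => //; exact: cov_OS. Qed.

Lemma sorted_cons_all v us : all (leq v) us -> sorted leq us -> sorted leq (v :: us).
Proof. by move=> h s; rewrite /= path_sortedE ?h //; exact: leq_trans. Qed.

Lemma open_outer_step gs c g k0 : (k0 <= H k (gmin g))%N ->
  (forall us, sorted leq us -> all (leq k0) us ->
    cov (OS c) us -> cov (alpha k) (map (H k) (map gmin gs) ++ us)) ->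
  open_outer (rcons gs g) c.
Proof.
move=> hk h; exists (H k (gmin g)) => us su au cu; rewrite !map_rcons cat_rcons; apply: h.
- exact: sorted_cons_all.
- by rewrite /= hk; apply: sub_all au => v; apply: leq_trans.
- by exists c.
Qed.

Lemma open_inner_step i n fs d f k0 : (k0 <= Nn n f)%N ->
  (forall us, sorted leq us -> all (leq k0) us ->
    cov (OS d) us -> cov (alpha i) (map (Nn n) fs ++ us)) ->
  open_inner i n (rcons fs f) d.
Proof.
move=> hk h; exists (Nn n f) => us su au cu; rewrite map_rcons cat_rcons; apply: h.
- exact: sorted_cons_all.
- by rewrite /= hk; apply: sub_all au => v; apply: leq_trans.
- by exists d.
Qed.

Lemma open_inner_cov i n fs d : open_inner i n fs d -> cov (alpha i) (map (Nn n) fs).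
Proof. by move=> [k0 /(_ [::])]; rewrite cats0; apply. Qed.

Lemma fresh_index (l : seq nat) n k0 : exists f,
  [/\ (n <= f)%N, (k0 <= f)%N & forall j, j \in l -> (j < f)%N].
Proof.
exists (maxn (maxn n k0) (\max_(j <- l) j).+1); split; rewrite ?leq_max ?leqnn ?orbT //.
by move=> j jl; rewrite !leq_max ltnS (big_rem j) //= leq_maxl orbT.
Qed.

Section Groups.
Variables (o c : ord) (n i : nat).
Hypothesis outer : forall gs, config gs -> open_outer gs c -> tderiv node_tree o (node gs).
Hypothesis n_gt0 : (0 < n)%N.
Hypothesis i_le_n : (i <= n)%N.
Hypothesis fits : ole (omul omega (alpha i)) (alpha n).

(** Prolonging a nonempty group spends inner steps only, so its remaining inner order [d] is added
    on top of the order [o] left to later groups. *)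
Lemma extend_group d gs fs : config (rcons gs (n, i, fs)) ->
  open_outer (rcons gs (n, i, fs)) c -> open_inner i n fs d ->
  tderiv node_tree (oadd o d) (node (rcons gs (n, i, fs))).
Proof.
elim: d fs => [|d IH|h IH] fs cf oo oi; first exact: outer.
- have [k0 hk0] := oi.
  have [f [nf k0f fresh]] := fresh_index (flatten (map snd (rcons gs (n, i, fs)))) n k0.
  have oi' : open_inner i n (rcons fs f) d.
    by apply: open_inner_step hk0; apply: leq_trans k0f (ltnW _); exact: Nn_gt.
  have [_ _ _ ne [al _]] : gok (n, i, fs) by case: cf => + _; apply; rewrite mem_rcons mem_head.
  have cf' : config (rcons gs (n, i, rcons fs f)).
    apply: config_rcons; first exact: config_rconsK cf.
      split=> //=; first by case: (fs).
      by split; [rewrite all_rcons nf|exact: open_inner_cov oi'].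
    rewrite /= -rcons_cat; move: fresh; rewrite flatten_rcons /= => fresh.
    by apply: sorted_rcons => //; case: cf => _; rewrite flatten_rcons.
  apply: (@tderiv_OS_intro _ _ _ [:: yv n f]) => //.
    by apply: IH => //; exact: open_inner_le.
  have -> : node (rcons gs (n, i, fs)) ++ [:: yv n f] = node (rcons gs (n, i, rcons fs f)).
    by rewrite !node_rcons /= map_rcons -cats1 catA.
  (* [gmin] sees only the first entry of a nonempty group, so appending [f] leaves the outer cover
     unchanged. *)
  apply: IH => //; case: oo => k1 hk1; exists k1 => us su au cu.
  have := hk1 us su au cu; rewrite !map_rcons /gmin /=.
  by case: (fs) ne.
- move=> j; apply: IH => //; have [k0 hk0] := oi; exists (maxn k0 j) => us su au cu.
  apply: hk0 => //; first by apply: sub_all au => v; rewrite geq_max => /andP[].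
  case: us cu au {su} => [//|u us] cu /= /andP[]; rewrite geq_max => /andP[_ ju] _.
  by apply/cov_OLE; exists j.
Qed.

(** The first vector of a group fixes [gmin] and thereby spends one outer step together with one
    inner step. *)
Lemma open_group d gs : config gs -> open_outer gs (OS c) -> open_inner i n [::] d ->
  tderiv node_tree (oadd o d) (node gs).
Proof.
elim: d => [|d IH|h IH] cf oo oi.
- by apply: outer => //; exact: open_outer_le.
- have [k0 hk0] := oi; have [k1 hk1] := oo.
  have [f [nf]] := fresh_index (flatten (map snd gs)) n (maxn k0 k1).
  rewrite geq_max => /andP[k0f k1f] fresh.
  have oi' : open_inner i n [:: f] d.
    by apply: (@open_inner_step i n [::] d f k0) hk0; apply: leq_trans k0f (ltnW _); exact: Nn_gt.
  apply: (@tderiv_OS_intro _ _ _ [:: yv n f]) => //.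
    by apply: IH => //; exact: open_inner_le.
  have -> : node gs ++ [:: yv n f] = node (rcons gs (n, i, [:: f])) by rewrite node_rcons.
  apply: extend_group => //.
    apply: config_rcons => //; first by split=> //=; split; [rewrite nf|exact: open_inner_cov oi'].
    by rewrite /= cats1; apply: sorted_rcons => //; case: cf.
  apply: open_outer_step hk1; apply: leq_trans k1f _; exact: HH_start.
- move=> j; apply: IH => //; have [k0 hk0] := oi; exists (maxn k0 j) => us su au cu.
  apply: hk0 => //; first by apply: sub_all au => v; rewrite geq_max => /andP[].
  case: us cu au {su} => [//|u us] cu /= /andP[]; rewrite geq_max => /andP[_ ju] _.
  by apply/cov_OLE; exists j.
Qed.

End Groups.

Variable Om : ord.
Hypothesis Om_le : ole Om (OL alpha).
Hypothesis cofinal : forall i, exists n,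
  [/\ (0 < n)%N, (i <= n)%N & ole (omul omega (alpha i)) (alpha n)].

(** A step of [c] is one group, whose inner order [alpha i] may be any term of the sequence, since a
    type [n] with [omega * alpha i] below [alpha n] exists. The supremum over [i] gives a factor
    [Om] per step. *)
Lemma tree_order c gs : config gs -> open_outer gs c ->
  tderiv node_tree (omul Om c) (node gs).
Proof.
elim: c gs => [|c IH|h IH] gs cf oo.
- by apply: node_l1 => //; have [k0 /(_ [::])] := oo; rewrite cats0; apply.
- apply: (tderiv_le (oadd_le2l (omul Om c) Om_le)) => i.
  have [n [n0 i_n fits]] := cofinal i.
  apply: (open_group IH n0 i_n fits) => //; by exists 0%N.
- move=> j; apply: IH => //; have [k0 hk0] := oo; exists (maxn k0 j) => us su au cu.
  apply: hk0 => //; first by apply: sub_all au => v; rewrite geq_max => /andP[].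
  case: us cu au {su} => [//|u us] cu /= /andP[]; rewrite geq_max => /andP[_ ju] _.
  by apply/cov_OLE; exists j.
Qed.

Lemma l1K_node_take K s p : l1K_node N K s -> l1K_node N K (take p s).
Proof.
move=> [h1 [h2 h3]]; have sz i : (i < size (take p s) -> i < p /\ i < size s)%N.
  by rewrite size_take_min leq_min => /andP[].
split; [|split].
- by move=> i /sz[? ?]; rewrite nth_take //; exact: h1.
- move=> i j /andP[ij jlt] a b; have [jp js] := sz _ jlt.
  by rewrite !nth_take ?(ltn_trans ij) //; apply: h2; rewrite ij.
(* Coefficients are extended by zero, and the estimate for the longer node is applied. *)
- move=> c; pose c' i := if (i < p)%N then c i else 0.
  have sumE (f : nat -> R) : (forall i, (p <= i)%N -> f i = 0) ->
      \sum_(i < size s) f i = \sum_(i < size (take p s)) f i.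
    move=> f0; rewrite -!(big_mkord predT f) (big_cat_nat _ (n := size (take p s))) //=; last first.
      by rewrite size_take_min geq_minr.
    rewrite [X in _ + X]big_nat_cond [X in _ + X]big1 ?addr0 // => i /andP[/andP[l u] _].
    by apply: f0; move: l; rewrite size_take_min geq_min (leqNgt (size s)) u orbF.
  have := h3 c'; rewrite (sumE (fun i => `|c' i|)); last first.
    by move=> i; rewrite /c' leqNgt => /negbTE ->; rewrite normr0.
  have -> : \sum_(i < size (take p s)) `|c' i| = \sum_(i < size (take p s)) `|c i|.
    by apply: eq_bigr => i _; rewrite /c' (sz i (ltn_ord i)).1.
  have -> // : (fun j => \sum_(i < size s) c' i * s`[i] j) =
      (fun j => \sum_(i < size (take p s)) c i * (take p s)`[i] j).
  apply/funext => j; rewrite (sumE (fun i => c' i * s`[i] j)); last first.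
    by move=> i; rewrite /c' leqNgt => /negbTE ->; rewrite mul0r.
  by apply: eq_bigr => i _; rewrite /c' (sz i (ltn_ord i)).1 nth_take // (sz i (ltn_ord i)).1.
Qed.

(** The order is computed at the empty node, which an [l1K_tree] excludes; survival of that node at
    [OS b] provides a nonempty node surviving at [b]. *)
Lemma lower_tree b : olt b (omul Om (alpha k)) ->
  exists T, l1K_tree N (2 / theta k) T /\ tderiv T b !=set0.
Proof.
move=> /ole_SE lt; pose T : set (seq (nat -> R)) := [set s | s <> [::] /\ node_tree s].
have sub b' t : tderiv node_tree b' t -> t <> [::] -> tderiv T b' t.
  elim: b' t => [//|b' IH|f IH] t; last by move=> h ne j; exact: IH.
  move=> [h1 [u [h2 [h3 h4]]]] ne; split; first exact: IH.
  by exists u; split; [apply: IH => // e; rewrite e in h3|].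
have : tderiv node_tree (omul Om (alpha k)) (node [::]).
  by apply: tree_order => //; exists 0%N.
move=> /(tderiv_le lt)[_ [t [ht [st _]]]]; exists T; split; last first.
  by exists t; apply: sub => // e; rewrite e in st.
split; first by move=> s [].
split; last by move=> s [].
move=> s p [ne hs] p0; split; last exact: l1K_node_take.
by case: (s) p p0 ne => [//|y s'] [].
Qed.

End LowerBound.

(** * Choice of the scales and conclusion *)

(** As the supremum is not attained, finitely many terms can be discarded: otherwise [x] and the
    largest of them would bound all [alpha n] strictly below [Om]. *)
Lemma cofinal_above (alpha : nat -> ord) Om x i : ole Om (OL alpha) ->
  (forall n, olt (alpha n) Om) -> olt x Om -> exists2 n, (i <= n)%N & ole x (alpha n).
Proof.
move=> sup lt xOm; apply: contrapT => no.
have [m _ hm] := ole_max_below alpha i.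
have [y yOm hy] : exists2 y, olt y Om & ole x y /\ ole (alpha m) y.
  by have [h|h] := ole_total x (alpha m); [exists (alpha m)|exists x].
apply: (olt_irr (a := y)); apply: olt_le_trans yOm (ole_trans sup _); apply/ole_LE => n.
have [ni|/ltnW in'] := leqP n i; first by apply: ole_trans (hm n ni) hy.2.
have [h|h] := ole_total x (alpha n); first by case: no; exists n.
exact: ole_trans h hy.1.
Qed.

(** For each [n] only the finitely many [i <= n] are compared, so a maximum of comparison functions
    serves. It depends on [alpha] alone and is thus available before any scale is fixed. *)
Lemma uniform_domination (alpha : nat -> ord) : exists Psi : nat -> nat -> nat,
  (forall n, {homo Psi n : v w / (v <= w)%N}) /\
  forall i n, (i <= n)%N -> ole (omul omega (alpha i)) (alpha n) ->
    dominates (Psi n) (omul omega (alpha i)) (alpha n).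
Proof.
have /choice[Psi hPsi] : forall n, exists psi : nat -> nat, {homo psi : v w / (v <= w)%N} /\
    forall i, (i <= n)%N -> ole (omul omega (alpha i)) (alpha n) ->
      dominates psi (omul omega (alpha i)) (alpha n).
  move=> n.
  have /choice[p hp] : forall i, exists q, {homo q : v w / (v <= w)%N} /\
      (ole (omul omega (alpha i)) (alpha n) -> dominates q (omul omega (alpha i)) (alpha n)).
    move=> i; have [h|no] := pselect (ole (omul omega (alpha i)) (alpha n)).
      by have [q ? ?] := ole_dominates h; exists q.
    by exists (fun v => v); split.
  exists (fun v => \max_(i < n.+1) p i v)%N; split.
    move=> v w vw; apply/bigmax_leqP => i _; apply: leq_trans (leq_bigmax i).
    exact: (hp i).1.
  move=> i i_n h; apply: dominates_le ((hp i).2 h) => v; have i_n' : (i < n.+1)%N by [].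
  exact: (leq_bigmax (F := fun i : 'I_n.+1 => p i v) (Ordinal i_n')).
exists Psi; split=> [n|i n]; first exact: (hPsi n).1.
exact: (hPsi n).2.
Qed.

Theorem theorem22 (R : realType) (xi : ord) (alpha : nat -> ord) (theta : nat -> R) :
  olt OZ xi ->
  oeq (OL alpha) (oexp omega (oexp omega xi)) ->
  (forall n, olt (alpha n) (oexp omega (oexp omega xi))) ->
  (forall n, (0 < n)%N -> 0 < theta n < 1) ->
  (forall n, (0 < n)%N -> theta n.+1 <= theta n) ->
  (forall e : R, 0 < e -> exists M, forall n, (M <= n)%N -> theta n < e) ->
  exists Fs : nat -> set (set nat),
    (forall n, regular (Fs n)) /\
    (forall n, CB_index (Fs n) (alpha n)) /\
    Ib_eq (Tnorm (Fs 0%N) Fs theta)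
          (oexp omega (omul (oexp omega xi) (ofin 2))).
Proof.
move=> xi0 [supU supL] lt theta01 theta_dec theta_null.
have [Psi [Psi_mono PsiP]] := uniform_domination alpha.
have /choice[jn jnP] : forall n, exists j, (0 < n)%N -> theta 1 ^+ j <= theta n.
  case=> [|n]; first by exists 0%N.
  have [t0 _] := andP (theta01 n.+1 isT).
  by have [j /ltW h] := expr_small (theta01 1%N isT) t0; exists j.
have /choice[Cn CnP] : forall n, exists C : nat, (0 < n)%N -> (theta n)^-1 <= C%:R.
  by move=> n; exists (Num.truncn (theta n)^-1).+1 => _; apply/ltW/truncnS_gt.
have Hm := @HH_mono alpha Psi jn Cn Psi_mono.
pose Fs n := Fam (HH alpha Psi jn Cn n) (alpha n).
exists Fs; split; first by move=> n; exact: Fam_regular.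
split; first by move=> n; apply: Fam_CB_index => //; exact: HH_unb.
split=> [K T K1 tr|b]; first exact: (Ib_upper Hm theta01 theta_dec theta_null xi0 lt supU K1 tr).
rewrite /= oadd0o oexpD => bg.
(* The index produced by the limit may be 0, for which there is no factor theta; a larger index with
   at least the same ordinal replaces it. *)
have [k k0 bk] : exists2 k, (0 < k)%N & olt b (omul (oexp omega (oexp omega xi)) (alpha k)).
  have /olt_LE[j hj] := olt_le_trans bg (omul_le2l _ supL).
  have [k k0 jk] := cofinal_above 1 supL lt (lt j).
  by exists k => //; apply: olt_le_trans hj (omul_le2l _ jk).
have [t0 t1] := andP (theta01 k k0).
have [|T [tr ne]] := lower_tree Psi_mono theta01 theta_dec jnP CnP PsiP k0 supL _ bk.
  (* [omega * alpha i] is below [Om] because [Om] is closed under products and exceeds omega. *)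
  move=> i; have [n] := cofinal_above (maxn i 1) supL lt
    (oexpW_mulclosed xi0 (omega_lt_oexpW xi0) (lt i)).
  by rewrite geq_max => /andP[i_n n0] h; exists n.
exists (2 / theta k), T; split=> //; rewrite ler_pdivlMr // mul1r; lra.
Qed.
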